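(* There exists an absolute constant $C>0$ such that the following holds for every $n\geq 1$. Let $\{P_i : i\in I\}$ be a family of closed half-spaces in $\mathbb{R}^n$ such that $\left|\bigcap_{i\in I}P_i\right|>0$. Then there exist $s\leq 2n$ and $i_1,\ldots,i_s\in I$ such that $$|P_{i_1}\cap\cdots\cap P_{i_s}|\leq (Cn)^{\frac{3n}{2}}\left|\bigcap_{i\in I}P_i\right|.$$
   Context: $|\cdot|$ denotes $n$-dimensional volume (Lebesgue measure) in $\mathbb{R}^n$, with values in $[0,+\infty]$. A closed half-space is a set of the form $\{x\in\mathbb{R}^n : \langle x,u\rangle\leq b\}$ with $u\neq 0$ and $b\in\mathbb{R}$. The family may be infinite. ''Absolute constant'' means a constant independent of the dimension $n$ and of the family. *)

(* Defs.v *)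
From HB Require Import structures.
From mathcomp Require Import all_boot all_order all_algebra.
From mathcomp Require Import all_classical all_reals all_analysis.

Set Implicit Arguments.
Unset Strict Implicit.
Unset Printing Implicit Defensive.
Import Order.TTheory GRing.Theory Num.Theory.
Import numFieldNormedType.Exports.

Local Open Scope classical_set_scope.
Local Open Scope ring_scope.

(* R^n is 'rV[R]_n, with the sigma-algebra generated by the coordinate maps,
   i.e. the Borel sigma-algebra. *)

Definition coord_rV (R : realType) (n : nat) (i : 'I_n) (x : 'rV[R]_n) :
  measurableTypeR R := x ord0 i.

Definition measure_rV_display : measure_display.
Proof. exact. Qed.

Section measurable_rV.
Context (R : realType) (n : nat).

Let rV_set0 : g_sigma_preimage (@coord_rV R n) set0.
Proof. exact: sigma_algebra0. Qed.

Let rV_setC (A : set 'rV[R]_n) :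
  g_sigma_preimage (@coord_rV R n) A -> g_sigma_preimage (@coord_rV R n) (~` A).
Proof. exact: sigma_algebraC. Qed.

Let rV_bigcup (F : (set 'rV[R]_n)^nat) :
  (forall i, g_sigma_preimage (@coord_rV R n) (F i)) ->
  g_sigma_preimage (@coord_rV R n) (\bigcup_i (F i)).
Proof. exact: sigma_algebra_bigcup. Qed.

HB.instance Definition _ := @isMeasurable.Build measure_rV_display
  'rV[R]_n (g_sigma_preimage (@coord_rV R n)) rV_set0 rV_setC rV_bigcup.

Lemma measurable_coord_rV (i : 'I_n) :
  measurable_fun [set: 'rV[R]_n] (@coord_rV R n i).
Proof.
move=> _ Y mY; rewrite setTI; apply: sub_sigma_algebra => /=.
rewrite -bigcup_seq/=; exists i => /=; first by rewrite mem_index_enum.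
by exists Y => //; rewrite setTI.
Qed.

Lemma measurable_fun_rVP d (T : measurableType d) (f : T -> 'rV[R]_n) :
  (forall i, measurable_fun [set: T] (@coord_rV R n i \o f)) ->
  measurable_fun [set: T] f.
Proof.
move=> mf; suff prefS : g_sigma_preimage
    (fun i => @coord_rV R n i \o f) `<=` measurable.
  by move=> _ A mA; apply: prefS; rewrite g_sigma_preimage_comp; exists A.
apply: smallest_sub; first exact: sigma_algebra_measurable.
rewrite -bigcup_seq; apply: bigcup_sub => i _ A [B mB <-]; exact: mf.
Qed.

End measurable_rV.

Section lebesgue_measure_rV.
Context (R : realType).
Local Open Scope ereal_scope.

Definition cons_rV n (p : measurableTypeR R * 'rV[R]_n) : 'rV[R]_n.+1 :=
  row_mx (p.1)%:M p.2.

Lemma cons_rV0 n (p : measurableTypeR R * 'rV[R]_n) :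
  cons_rV p ord0 ord0 = p.1.
Proof.
have := row_mxEl (p.1)%:M p.2 ord0 ord0; rewrite [RHS]mxE eqxx mulr1n => <-.
by rewrite /cons_rV; congr (row_mx _ _ _ _); exact/val_inj.
Qed.

Lemma cons_rVS n (p : measurableTypeR R * 'rV[R]_n) (i : 'I_n) :
  cons_rV p ord0 (lift ord0 i) = p.2 ord0 i.
Proof.
have <- := row_mxEr (p.1)%:M p.2 ord0 i.
by rewrite /cons_rV; congr (row_mx _ _ _ _); exact/val_inj.
Qed.

Lemma measurable_cons_rV n :
  measurable_fun [set: measurableTypeR R * 'rV[R]_n] (@cons_rV n).
Proof.
apply: measurable_fun_rVP => i; have [j ->|->] := unliftP ord0 i.
- rewrite (_ : _ \o _ = @coord_rV R n j \o snd); last first.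
    by apply/funext => p; rewrite /= /coord_rV cons_rVS.
  by apply: measurableT_comp => //; exact: measurable_coord_rV.
- rewrite (_ : _ \o _ = fst)//.
  by apply/funext => p; rewrite /= /coord_rV cons_rV0.
Qed.

Definition uncons_rV n (x : 'rV[R]_n.+1) : measurableTypeR R * 'rV[R]_n :=
  (x ord0 ord0, \row_i x ord0 (lift ord0 i))%R.

Lemma cons_rVK n : cancel (@cons_rV n) (@uncons_rV n).
Proof.
move=> [t x]; rewrite /uncons_rV cons_rV0; congr pair.
by apply/rowP => i; rewrite mxE cons_rVS.
Qed.

Lemma measurable_uncons_rV n : measurable_fun [set: 'rV[R]_n.+1] (@uncons_rV n).
Proof.
apply: measurable_fun_pair; first exact: (measurable_coord_rV ord0).
apply: measurable_fun_rVP => i.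
rewrite (_ : _ \o _ = @coord_rV R n.+1 (lift ord0 i)).
  exact: measurable_coord_rV.
by apply/funext => x; rewrite /= /coord_rV mxE.
Qed.

Section lebesgue_measure_rVS.
Variables (n : nat) (mu : {sigma_finite_measure set 'rV[R]_n -> \bar R}).

Definition lebesgue_measure_rVS : set 'rV[R]_n.+1 -> \bar R :=
  pushforward (@lebesgue_measure R \x mu) (@cons_rV n).

HB.instance Definition _ := Measure.copy lebesgue_measure_rVS
  (measure_function_pushforward__canonical__measure_function_Measure
     (lebesgue_measure \x mu) (@measurable_cons_rV n)).

Let sigma_finite_rVS : sigma_finite [set: 'rV[R]_n.+1] lebesgue_measure_rVS.
Proof.
have /sigma_finiteP[F [FT ndF Foo]] := sigma_finiteT (@lebesgue_measure R).
have /sigma_finiteP[G [GT ndG Goo]] := sigma_finiteT mu.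
exists (fun k => @uncons_rV n @^-1` (F k `*` G k)).
  rewrite -preimage_bigcup; apply/esym/seteqP; split=> // x _.
  have : setT (uncons_rV x).1 by []. rewrite FT => -[k _ Fk].
  have : setT (uncons_rV x).2 by []. rewrite GT => -[l _ Gl].
  exists (maxn k l) => //; split.
    by move: Fk; exact/subsetPset/ndF/leq_maxl.
  by move: Gl; exact/subsetPset/ndG/leq_maxr.
move=> k; have [mF Fk] := Foo k; have [mG Gk] := Goo k; split.
  rewrite -[X in measurable X]setTI; apply: measurable_uncons_rV => //.
  exact: measurableX.
rewrite /lebesgue_measure_rVS /pushforward -comp_preimage.
rewrite (_ : _ \o _ = id); last by apply/funext => p; exact: cons_rVK.
by rewrite preimage_id product_measure1E// lte_mul_pinfty// ge0_fin_numE.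
Qed.

HB.instance Definition _ := Measure_isSigmaFinite.Build _ _ _
  lebesgue_measure_rVS sigma_finite_rVS.

End lebesgue_measure_rVS.

Fixpoint lebesgue_measure_rV (n : nat) :
    {sigma_finite_measure set 'rV[R]_n -> \bar R} :=
  match n with
  | 0 => \d_(0%R : 'rV[R]_0)
  | m.+1 => lebesgue_measure_rVS (lebesgue_measure_rV m)
  end.

Lemma measurable_box_rV n (A : 'I_n -> set (measurableTypeR R)) :
  (forall i, measurable (A i)) ->
  measurable [set x : 'rV[R]_n | forall i, A i (x ord0 i)].
Proof.
move=> mA.
rewrite (_ : [set _ | _] = \bigcap_(i in [set: 'I_n]) @coord_rV R n i @^-1` A i).
  apply: fin_bigcap_measurable => // i _.
  by rewrite -[X in measurable X]setTI; exact: measurable_coord_rV.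
by apply/seteqP; split=> x /= h i => [_|]; exact: h.
Qed.

(* lebesgue_measure_rV is defined by iterated products; this box formula, together
   with sigma-additivity, characterizes it on the Borel sets. *)
Lemma lebesgue_measure_rV_box n (A : 'I_n -> set (measurableTypeR R)) :
  (forall i, measurable (A i)) ->
  lebesgue_measure_rV n [set x | forall i, A i (x ord0 i)] =
  \prod_(i < n) lebesgue_measure (A i).
Proof.
elim: n => [|n ih] in A * => mA.
  by rewrite big_ord0 /= diracE mem_set//= => -[].
have mA' i : measurable (A (lift ord0 i)) by exact: mA.
rewrite big_ord_recl -(ih _ mA').
rewrite -(product_measure1E _ _ (mA ord0) (measurable_box_rV mA')).
rewrite /= /lebesgue_measure_rVS /pushforward; congr (_ _).
apply/seteqP; split=> -[t x]/= => [h|[h0 h] i].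
  by split=> [|i]; [have := h ord0; rewrite cons_rV0|
                    have := h (lift ord0 i); rewrite cons_rVS].
by have [j ->|->] := unliftP ord0 i; rewrite ?cons_rV0 ?cons_rVS.
Qed.

End lebesgue_measure_rV.

Definition dot_rV (R : realType) (n : nat) (x u : 'rV[R]_n) : R :=
  \sum_(i < n) x ord0 i * u ord0 i.

Definition closed_half_space (R : realType) (n : nat) (H : set 'rV[R]_n) : Prop :=
  exists u : 'rV[R]_n, exists b : R, u != 0 /\ H = [set x | dot_rV x u <= b].

(* Main.v *)
(* Idea. If P has infinite volume, the empty subfamily works. Otherwise a simplex in P of
   nearly maximal volume has a centroid o about which P is balanced up to the factor
   k = 2 (n + 1), that is -(P - o) is contained in k (P - o); put o = 0 and write the
   half-spaces as <x, a_i> <= 1. Among the n-tuples of normals a_i take one with nearly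
   maximal determinant, with matrix A, and let l_i be the coordinate vectors of the a_i in
   this basis. A nearly D-optimal design M = sum_i c_i l_i^T l_i satisfies
   l_i M^-1 l_i^T <= 8 n for all i (Kiefer-Wolfowitz), so an explicit parallelepiped inside
   the ellipsoid of M lies in P, while Cauchy-Binet and the choice of A give
   det M <= 4 / n!; this bounds |P| from below.
   On P the functional -sum_j <x, a_j> over the n chosen normals is at most n k, and by
   Helly's theorem n further half-spaces of the family force it to be at most n k + 1. The
   2 n half-spaces then cut out a subset of a simplex, whose volume is bounded by covering it
   with cubes. Everywhere "nearly maximal" means up to a factor 2, so no maximum has to be
   attained. *)

Require Import Defs.
From mathcomp Require Import all_boot all_order all_fingroup all_algebra.
From mathcomp Require Import all_classical all_reals all_analysis.
From mathcomp Require Import finmap measurable_realfun.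
From mathcomp Require Import ring lra.

Set Implicit Arguments.
Unset Strict Implicit.
Unset Printing Implicit Defensive.
Import Order.TTheory GRing.Theory Num.Theory.
Import numFieldNormedType.Exports.

Local Open Scope classical_set_scope.
Local Open Scope ring_scope.

(** * Affine changes of variables for Lebesgue measure *)

Section affine1.
Context (R : realType).
Local Notation lam := (@lebesgue_measure R).

Let aff (a b : R) := fun t : measurableTypeR R => a * t + b : measurableTypeR R.

Let maff (a b : R) : measurable_fun setT (aff a b).
Proof. by apply: measurable_funD => //; exact: measurable_funM. Qed.

Lemma preimage_affine_itv (a b x y : R) : a != 0 ->
  aff a b @^-1` `]x, y] =
  [set` if 0 < a then `](x - b) / a, (y - b) / a] else `[(y - b) / a, (x - b) / a[].
Proof.
move=> a0; apply/seteqP; split => t; rewrite /aff /=; case: ltP => a0';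
  rewrite !in_itv/= ?ltr_pdivrMr ?ler_pdivlMr //.
- by rewrite ltrBlDr lerBrDr mulrC.
- have {a0 a0'}a0 : a < 0 by rewrite lt_neqAle a0.
  rewrite ler_ndivrMr// ltr_ndivlMr// lerBrDr ltrBlDr mulrC.
  by move=> /andP[-> ->].
- by rewrite ltrBlDr lerBrDr mulrC.
- have {a0 a0'}a0 : a < 0 by rewrite lt_neqAle a0.
  rewrite ler_ndivrMr// ltr_ndivlMr// lerBrDr ltrBlDr mulrC.
  by move=> /andP[-> ->].
Qed.

(** Uniqueness of Lebesgue measure: [|a|] times the pushforward has the right value on every []x,
    y]]. *)
Lemma lebesgue_measure_affine (a b : R) (A : set (measurableTypeR R)) :
  a != 0 -> measurable A -> lam (aff a b @^-1` A) = (`|a|^-1%:E * lam A)%E.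
Proof.
move=> a0 mA.
have na0 : 0 < `|a| by rewrite normr_gt0.
pose mp := measure_function_pushforward__canonical__measure_function_Measure lam (maff a b).
pose nu := mscale (NngNum (ltW na0)) mp.
suff -> : lam A = nu A.
  by rewrite /nu /mscale /= muleA -EFinM mulVf ?gt_eqF// mul1e.
apply: lebesgue_measure_unique => // _ [[x y]] _ <-.
transitivity (`|a|%:E * lam (aff a b @^-1` `]x, y]))%E => //.
rewrite preimage_affine_itv// lebesgue_measure_itv/= lte_fin.
have [a_gt0|a_le0] := ltP 0 a; rewrite lebesgue_measure_itv/= lte_fin.
  rewrite ltr_pM2r ?invr_gt0// ltrD2r; case: ifPn => _; rewrite ?mule0//.
  by rewrite -!EFinD -EFinM gtr0_norm//; congr EFin; field.
have {a_le0}a_lt0 : a < 0 by rewrite lt_neqAle a0.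
rewrite ltr_nM2r ?invr_lt0// ltrD2r; case: ifPn => _; rewrite ?mule0//.
by rewrite -!EFinD -EFinM ltr0_norm//; congr EFin; field.
Qed.

Lemma ge0_integral_affine (a b : R) (f : R -> \bar R) : a != 0 ->
  measurable_fun [set: measurableTypeR R] f -> (forall t, 0 <= f t)%E ->
  (\int[lam]_t f (a * t + b)%R = `|a|^-1%:E * \int[lam]_t f t)%E.
Proof.
move=> a0 mf f0.
have na0 : 0 <= `|a|^-1 by rewrite invr_ge0.
transitivity (\int[mscale (NngNum na0) lam]_t f t)%E; last first.
  by rewrite ge0_integral_mscale.
transitivity (\int[pushforward lam (aff a b)]_t f t)%E.
  by rewrite (ge0_integral_pushforward (maff a b)).
pose mp := measure_function_pushforward__canonical__measure_function_Measure lam (maff a b).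
apply: (@eq_measure_integral _ _ _ setT (mscale (NngNum na0) lam) mp) => A mA _.
by rewrite [LHS](lebesgue_measure_affine b a0 mA).
Qed.
End affine1.

Section affine.
Context (R : realType).
Local Notation lam := (@lebesgue_measure R).
Local Notation mu n := (lebesgue_measure_rV R n).

Lemma measurable_affine_rV n (T : 'M[R]_n) (c : 'rV[R]_n) :
  measurable_fun [set: 'rV[R]_n] (fun x : 'rV[R]_n => x *m T + c).
Proof.
apply: measurable_fun_rVP => i.
rewrite (_ : _ \o _ = (fun x => (\sum_j @coord_rV R n j x * T j i) + c ord0 i)); last first.
  by apply/funext => x; rewrite /= /coord_rV !mxE.
apply: measurable_funD => //; apply: measurable_sum => j.
by apply: measurable_funM => //; exact: measurable_coord_rV.
Qed.

Lemma lebesgue_measure_rVS_by_xsection n (A : set 'rV[R]_n.+1) :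
  (mu n.+1 A = \int[lam]_t mu n [set x | A (cons_rV (t, x))])%E.
Proof.
rewrite /= /lebesgue_measure_rVS /pushforward /product_measure1.
by apply: eq_integral => t _ /=; rewrite xsectionE.
Qed.

Lemma lebesgue_measure_rVS_by_ysection n (A : set 'rV[R]_n.+1) : measurable A ->
  (mu n.+1 A = \int[mu n]_x lam [set t | A (cons_rV (t, x))])%E.
Proof.
move=> mA.
have mcA : measurable (@cons_rV R n @^-1` A).
  by rewrite -[X in measurable X]setTI; exact: measurable_cons_rV.
transitivity ((lam \x^ mu n) (@cons_rV R n @^-1` A))%E.
  apply: product_measure_unique => // X Y mX mY; exact: product_measure2E.
by apply: eq_integral => t _ /=; rewrite ysectionE.
Qed.

Lemma measurable_xsection_rV n (A : set 'rV[R]_n.+1) (t : R) : measurable A ->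
  measurable [set x | A (cons_rV (t, x))].
Proof.
move=> mA; have mcA : measurable (@cons_rV R n @^-1` A).
  by rewrite -[X in measurable X]setTI; exact: measurable_cons_rV.
by have := measurable_xsection t mcA; rewrite xsectionE.
Qed.

Lemma measurable_ysection_rV n (A : set 'rV[R]_n.+1) x : measurable A ->
  measurable [set t : measurableTypeR R | A (cons_rV (t, x))].
Proof.
move=> mA; have mcA : measurable (@cons_rV R n @^-1` A).
  by rewrite -[X in measurable X]setTI; exact: measurable_cons_rV.
by have := measurable_ysection x mcA; rewrite ysectionE.
Qed.

Lemma measurable_fun_xsection_rV n (A : set 'rV[R]_n.+1) : measurable A ->
  measurable_fun [set: measurableTypeR R] (fun t => mu n [set x | A (cons_rV (t, x))]).
Proof.
move=> mA; have mcA : measurable (@cons_rV R n @^-1` A).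
  by rewrite -[X in measurable X]setTI; exact: measurable_cons_rV.
have := measurable_fun_xsection (mu n) mcA.
by congr measurable_fun; apply/funext => t /=; rewrite xsectionE.
Qed.

(** The translation [c] is built in because, after splitting off the first coordinate, each section
    is moved by a vector that depends on that coordinate. *)
Definition scales_volume n (T : 'M[R]_n) := forall (c : 'rV[R]_n) (A : set 'rV[R]_n),
  measurable A ->
  (mu n ((fun x : 'rV[R]_n => (x *m T + c)%R) @^-1` A) = `|\det T|^-1%:E * mu n A)%E.

Lemma scales_volumeM n (S T : 'M[R]_n) :
  (forall A, measurable A ->
    (mu n (mulmx^~ S @^-1` A) = `|\det S|^-1%:E * mu n A)%E) ->
  scales_volume T -> scales_volume (S *m T).
Proof.
move=> hS hT c A mA.
have mTA : measurable ((fun x => x *m T + c) @^-1` A).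
  by rewrite -[X in measurable X]setTI; exact: measurable_affine_rV.
rewrite det_mulmx normrM invfM EFinM -muleA -(hT c)// -hS//.
by congr (mu n _); apply/seteqP; split => x /=; rewrite mulmxA.
Qed.

(** Fubini with the first coordinate outermost: the section at [t] of the preimage is the preimage
    under [S], translated by a multiple of [r], of the section at [a * t + c 0 0]. A one-dimensional
    change of variable then gives the factor from [a]. *)
Lemma scales_volume_ublock n (a : R) (r : 'rV[R]_n) (S : 'M[R]_n) :
  a != 0 -> scales_volume S ->
  scales_volume (block_mx a%:M r 0 S : 'M[R]_(1 + n)).
Proof.
move=> a0 hS c A mA.
rewrite det_ublock det_scalar1 normrM invfM EFinM -muleA.
rewrite [in RHS]lebesgue_measure_rVS_by_xsection muleCA.
rewrite -(@ge0_integral_affine R a (c 0 0))//; last exact: measurable_fun_xsection_rV.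
rewrite lebesgue_measure_rVS_by_xsection -ge0_integralZl//; last first.
  apply: (measurableT_comp (measurable_fun_xsection_rV mA)).
  by apply: measurable_funD => //; exact: measurable_funM.
apply: eq_integral => t _.
have mAt := measurable_xsection_rV (a * t + c 0 0) mA.
rewrite -(hS (t *: r + rsubmx (c : 'rV_(1 + n))))//; congr (mu n _).
apply/funext => x /=; congr A.
rewrite /cons_rV /= mul_row_block mulmx0 addr0.
rewrite -[c in LHS](@hsubmxK _ _ 1 n) add_row_mx; congr row_mx.
  apply/rowP => i; rewrite !ord1 !mxE big_ord1 !mxE eqxx !mulr1n mulrC.
  by congr (_ + c _ _); apply: val_inj.
by rewrite mul_scalar_mx addrA (addrC (x *m S)).
Qed.

(** Fubini with the first coordinate innermost: this shear only translates each line parallel to the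
    first axis. *)
Lemma lebesgue_measure_rV_lblock n (l : 'cV[R]_n) (A : set 'rV[R]_n.+1) :
  let T := block_mx 1%:M 0 l 1%:M : 'M[R]_(1 + n) in
  measurable A -> (mu n.+1 (mulmx^~ T @^-1` A) = `|\det T|^-1%:E * mu n.+1 A)%E.
Proof.
move=> T mA.
rewrite det_lblock !det1 mulr1 normr1 invr1 mul1e.
have mTA : measurable (mulmx^~ T @^-1` A).
  rewrite -[X in measurable X]setTI.
  have := @measurable_affine_rV n.+1 T 0; under eq_fun do rewrite addr0; exact.
rewrite !lebesgue_measure_rVS_by_ysection//; apply: eq_integral => x _.
transitivity (lam ((fun t => 1 * t + (x *m l) 0 0) @^-1` [set t | A (cons_rV (t, x))])).
  congr (lam _); apply/funext => t /=; congr A.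
  rewrite /T /cons_rV /= mul_row_block mulmx0 add0r !mulmx1 mul1r.
  suff -> : t%:M + x *m l = (t + (x *m l) 0 0)%:M by [].
  by apply/rowP => i; rewrite !ord1 !mxE eqxx !mulr1n.
rewrite lebesgue_measure_affine ?oner_neq0 ?normr1 ?invr1 ?mul1e//.
exact: measurable_ysection_rV.
Qed.

(** Induction on [n] by Gaussian elimination. A nonzero top-left entry allows a factorization into a
    shear and a block triangular matrix whose lower block is the Schur complement. *)
Theorem unitmx_scales_volume n (T : 'M[R]_n) : T \in unitmx -> scales_volume T.
Proof.
elim: n T => [|n IH] T uT.
  move=> c A mA; rewrite det_mx00 normr1 invr1 mul1e; congr (mu 0 _).
  by apply/funext => x /=; congr A; rewrite [LHS]thinmx0 [RHS]thinmx0.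
have key (T' : 'M[R]_(1 + n)) : T' 0 0 != 0 -> T' \in unitmx -> scales_volume T'.
  move=> a0 uT'.
  pose a := T' 0 0; pose r := ursubmx T'; pose c := dlsubmx T'; pose S := drsubmx T'.
  have ulE : ulsubmx T' = a%:M.
    by rewrite [LHS]mx11_scalar !mxE; congr (T' _ _)%:M; apply: val_inj.
  have T'E : T' = block_mx 1%:M 0 (a^-1 *: c) 1%:M *m block_mx a%:M r 0 (S - a^-1 *: c *m r).
    rewrite mulmx_block !mul1mx !mul0mx !addr0.
    rewrite mul_mx_scalar scalerA divff// scale1r addrC subrK.
    by rewrite -[LHS]submxK ulE.
  have : \det T' != 0 by move: uT'; rewrite unitmxE unitfE.
  rewrite T'E det_mulmx det_lblock !det1 !mul1r det_ublock mulf_eq0 negb_or => /andP[_ dS].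
  apply: scales_volumeM; first by move=> A mA; exact: lebesgue_measure_rV_lblock.
  by apply: scales_volume_ublock => //; apply: IH; rewrite unitmxE unitfE.
have [a0|a0] := eqVneq ((T : 'M[R]_(1 + n)) 0 0) 0; last exact: key.
(* With a zero corner, some other entry of the first column is nonzero, as the determinant is. [U 1]
   adds that row to the first one, and [U (-1)] undoes this. *)
have [k Tk] : exists k : 'I_n, dlsubmx (T : 'M[R]_(1 + n)) k 0 != 0.
  apply/existsP; rewrite -[X in is_true X]negbK negb_exists; apply/negP => /forallP T0.
  move: uT; rewrite unitmxE unitfE (expand_det_col _ 0) big_ord_recl /= a0 mul0r add0r.
  rewrite big1 ?eqxx// => i _; have := T0 i; rewrite negbK !mxE => /eqP Ti.
  rewrite (_ : T _ _ = 0) ?mul0r// -[RHS]Ti; congr (T _ _); exact: val_inj.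
pose e : 'rV[R]_n := delta_mx 0 k.
pose U (s : R) : 'M[R]_(1 + n) := block_mx 1%:M (s *: e) 0 1%:M.
have UU : U (-1) *m U 1 = 1%:M.
  rewrite mulmx_block !mul1mx !mul0mx !mulmx0 !mulmx1 !addr0 !add0r.
  by rewrite -scalerDl subrr scale0r -scalar_mx_block.
have sU s : scales_volume (U s).
  by apply: scales_volume_ublock; [exact: oner_neq0|apply: IH; exact: unitmx1].
have -> : T = U (-1) *m (U 1 *m T) by rewrite mulmxA UU mul1mx.
apply: scales_volumeM.
  move=> A mA; rewrite -(sU (-1) 0)//; congr (mu _ _).
  by apply/funext => x /=; rewrite addr0.
apply: key.
  pose T' : 'M[R]_(1 + n) := T.
  have -> : (U 1 *m T) 0 0 = ulsubmx (U 1 *m T') 0 0.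
    by rewrite [RHS]mxE [RHS]mxE; congr ((_ *m _) _ _); exact: val_inj.
  rewrite -{1}[T']submxK mulmx_block block_mxKul mul1mx scale1r -rowE !mxE.
  rewrite (_ : T' _ _ = 0) ?add0r; last first.
    by rewrite -[RHS]a0; congr (T _ _); exact: val_inj.
  by move: Tk; rewrite !mxE.
by rewrite unitmx_mul uT andbT unitmxE det_ublock !det1 mulr1 unitr1.
Qed.
End affine.

(** * Borel sets, translations, parallelepipeds and hyperplanes *)

Section rV_measure.
Context (R : realType).
Local Notation lam := (@lebesgue_measure R).
Local Notation mu n := (lebesgue_measure_rV R n).

(** An open set is the countable union of the boxes with rational center and radius [1/(k+1)] that
    it contains. *)
Lemma open_measurable_rV n (U : set 'rV[R]_n) : open U -> measurable U.
Proof.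
move=> oU.
pose B (p : 'rV[rat]_n * nat) : set 'rV[R]_n := [set x | forall i,
  ball (ratr (p.1 ord0 i) : R) p.2.+1%:R^-1 (x ord0 i)].
pose F p := if `[< B p `<=` U >] then B p else set0.
have mB p : measurable (B p).
  apply: (@measurable_box_rV R n (fun i => ball (ratr (p.1 ord0 i) : R) p.2.+1%:R^-1)).
  by move=> i; exact: measurable_ball.
rewrite (_ : U = \bigcup_p F p).
  apply: countable_bigcupT_measurable; first exact: countableP.
  by move=> p; rewrite /F; case: ifP => // _; exact: measurable0.
apply/seteqP; split=> x; last first.
  by move=> [p _]; rewrite /F; case: ifPn => // /asboolP; exact.
move=> Ux; have /nbhs_ballP[e /= e0 xeU] : nbhs x U by exact: open_nbhs_nbhs.
(* Half of [e], since points of the box are compared with [x] through its rational center. *)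
have [k _ /(_ _ (leqnn _)) ke] := near_infty_natSinv_lt (PosNum (divr_gt0 e0 (ltr0n _ 2))).
rewrite /= in ke.
have /choice[q qx] (i : 'I_n) : exists q : rat, ball (x ord0 i) k.+1%:R^-1 (ratr q).
  have k0 : 0 < k.+1%:R^-1 :> R by rewrite invr_gt0.
  have [y [yB [q _ qy]]] := @dense_rat R (ball (x ord0 i) k.+1%:R^-1)
    (ex_intro _ (x ord0 i) (ballxx _ k0)) (ball_open _ _).
  by exists q; rewrite qy.
exists (\row_i q i, k) => //.
have Bx : B (\row_i q i, k) x by move=> i; rewrite mxE; exact/ball_sym/qx.
rewrite /F ifT//; apply/asboolP => y By; apply: xeU; split=> // i j; rewrite ord1.
have H1 : ball (x 0 j) (e / 2) (ratr (q j)) := le_ball (ltW ke) (qx j).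
have H2 : ball (ratr (q j) : R) (e / 2) (y 0 j).
  by have := By j; rewrite mxE; exact: le_ball (ltW ke) _.
exact: ball_splitr (ball_sym H1) H2.
Qed.

Lemma closed_measurable_rV n (U : set 'rV[R]_n) : closed U -> measurable U.
Proof.
move=> cU; rewrite -[U]setCK; apply: measurableC.
by apply: open_measurable_rV; exact: closed_openC.
Qed.

Lemma lebesgue_measure_rV_translate n (c : 'rV[R]_n) (A : set 'rV[R]_n) :
  measurable A -> mu n ((+%R^~ c) @^-1` A) = mu n A.
Proof.
move=> mA; have := unitmx_scales_volume (unitmx1 R n) c mA.
rewrite det1 normr1 invr1 mul1e => <-; congr (mu n _).
by apply/funext => x /=; rewrite mulmx1.
Qed.

Lemma lebesgue_measure_rV_parallelepiped n (T : 'M[R]_n) (c : 'rV[R]_n)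
    (B : 'I_n -> set (measurableTypeR R)) :
  T \in unitmx -> (forall i, measurable (B i)) ->
  (mu n [set x : 'rV[R]_n | forall i, B i ((x *m T + c)%R ord0 i)] =
    `|\det T|^-1%:E * \prod_(i < n) lam (B i))%E.
Proof.
move=> uT mB; rewrite -lebesgue_measure_rV_box//.
by rewrite -(unitmx_scales_volume uT c (measurable_box_rV mB)).
Qed.

(** The rank normal form of [u^T] makes the functional a multiple of the first coordinate of
    [x *m T], so the hyperplane is a parallelepiped with one side reduced to a point. *)
Lemma lebesgue_measure_rV_hyperplane n (u : 'rV[R]_n) (b : R) :
  u != 0 -> mu n [set x : 'rV[R]_n | dot_rV x u = b] = 0%E.
Proof.
case: n u => [u|n u]; first by rewrite [u]thinmx0 eqxx.
move=> u0; pose T := col_ebase u^T; pose r := row_ebase u^T 0 0.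
have uE : u^T = T *m (delta_mx 0 0 : 'M[R]_(n.+1, 1)) *m row_ebase u^T.
  rewrite -[LHS]mulmx_ebase.
  suff -> : pid_mx (\rank u^T) = delta_mx 0 0 :> 'M[R]_(n.+1, 1) by [].
  have -> : \rank u^T = 1%N.
    by apply/eqP; rewrite eqn_leq rank_leq_col lt0n mxrank_eq0 trmx_eq0.
  by apply/matrixP => i j; rewrite !mxE !ord1 ltnS leqn0 ?andbb ?andbT.
have r0 : r != 0.
  by have := row_ebase_unit u^T; rewrite unitmxE det_mx11 unitfE.
have dotE x : dot_rV x u = (x *m T) 0 0 * r.
  transitivity ((x *m u^T) 0 0).
    by rewrite !mxE; apply: eq_bigr => i _; rewrite !mxE.
  by rewrite uE !mulmxA mxE big_ord1 -colE mxE.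
pose B (i : 'I_n.+1) : set (measurableTypeR R) := if i == 0 then [set b / r] else setT.
have mB i : measurable (B i) by rewrite /B; case: ifP.
rewrite (_ : [set _ | _] = [set x : 'rV[R]_n.+1 | forall i, B i ((x *m T + 0)%R ord0 i)]).
  rewrite lebesgue_measure_rV_parallelepiped ?col_ebase_unit//.
  by rewrite big_ord_recl /B/= lebesgue_measure_set1 mul0e mule0.
apply/seteqP; split => x /=; rewrite addr0 dotE.
  by move=> xb i; rewrite /B; case: eqP => // -> /=; rewrite -xb mulfK.
by move=> /(_ 0); rewrite /B/= => ->; rewrite divfK.
Qed.

End rV_measure.

(** * Nearly maximal determinants *)

Section linear_algebra.
Context (R : realType).

Lemma dot_rVE n (x u : 'rV[R]_n) : dot_rV x u = (x *m u^T) 0 0.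
Proof. by rewrite !mxE; apply: eq_bigr => i _; rewrite !mxE. Qed.

(** Greedy choice: while fewer than [n] rows are chosen, some nonzero column [u] is killed by all of
    them, and an element of [S] not killed by [u] is independent of them. *)
Lemma unitmx_of_spanning n (S : set 'rV[R]_n) :
  (forall u : 'cV[R]_n, u != 0 -> exists2 x, S x & x *m u != 0) ->
  exists A : 'M[R]_n, (forall i, S (row i A)) /\ A \in unitmx.
Proof.
move=> spS.
suff /(_ _ (leqnn n))[A [SA fA]] k : (k <= n)%N ->
    exists X : 'M[R]_(k, n), (forall i, S (row i X)) /\ row_free X.
  by exists A; split=> //; rewrite -row_free_unit.
elim: k => [_|k IH kn].
  by exists 0; split; [case|apply: inj_row_free => v _; exact: thinmx0].
have [X [SX fX]] := IH (ltnW kn).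
have : cokermx X != 0.
  by rewrite -mxrank_eq0 mxrank_coker (eqP (fX : \rank X == k)) subn_eq0 -ltnNge.
move=> /eqP/matrixP/existsNP[i /existsNP[j]]; rewrite [X in _ = X]mxE => /eqP Cij.
pose u := col j (cokermx X).
have Xu : X *m u = 0 by rewrite /u colE mulmxA mulmx_coker mul0mx.
have [|x Sx xu] := spS u.
  by apply: contraNneq Cij => /matrixP/(_ i 0); rewrite !mxE => ->.
exists (col_mx x X : 'M[R]_(1 + k, n)); split.
  suff : forall l : 'I_(1 + k), S (row l (col_mx x X)) by [].
  move=> l; case: (split_ordP l) => l' ->.
    by rewrite rowKu; rewrite [l']ord1 row_id.
  by rewrite rowKd.
suff : @row_free R (1 + k) n (col_mx x X) by [].
apply: inj_row_free => v; rewrite -[v](@hsubmxK _ _ 1 k).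
set a := lsubmx _; set w := rsubmx _; rewrite mul_row_col => vX0.
have /eqP : a *m (x *m u) = 0.
  by move: (congr1 (mulmx^~ u) vX0); rewrite mul0mx mulmxDl -!mulmxA Xu mulmx0 addr0.
move/eqP => axu.
have aE : a = 0.
  move/eqP: axu; rewrite [a]mx11_scalar mul_scalar_mx scaler_eq0 (negbTE xu) orbF.
  by move=> /eqP ->; rewrite raddf0.
rewrite aE mul0mx add0r in vX0.
by rewrite aE (row_free_inj fX (etrans vX0 (esym (mul0mx _ X)))) row_mx0.
Qed.

(** Cramer's rule. *)
Lemma det_replace_row n (A : 'M[R]_n) (a : 'rV[R]_n) (k : 'I_n) : A \in unitmx ->
  \det (\matrix_(i, j) (if i == k then a 0 j else A i j)) =
  (a *m invmx A) 0 k * \det A.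
Proof.
move=> uA; rewrite (expand_det_row _ k) /invmx uA -scalemxAr mxE.
rewrite mulrAC mulVf ?mul1r; last by move: uA; rewrite unitmxE unitfE.
rewrite mxE; apply: eq_bigr => j _; rewrite !mxE eqxx; congr (_ * _).
rewrite /cofactor; congr (_ * \det _); apply/matrixP => p q; rewrite !mxE.
by rewrite eq_sym (negbTE (neq_lift _ _)).
Qed.

Lemma near_maximizer (E : set R) (x0 D : R) :
  E x0 -> 0 < x0 -> (forall x, E x -> x <= D) ->
  exists x, [/\ E x, 0 < x & forall y, E y -> y <= 2 * x].
Proof.
move=> Ex0 x0_gt0 bE.
have supE : has_sup E by split; [exists x0|exists D].
have sE_gt0 : 0 < sup E by apply: lt_le_trans x0_gt0 (ub_le_sup supE.2 Ex0).
have [x Ex /ltW] := sup_adherent (divr_gt0 sE_gt0 (ltr0n _ 2)) supE.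
have -> : sup E - sup E / 2 = sup E / 2 by field.
rewrite ler_pdivrMr// mulrC => lex; exists x; split=> //.
  by rewrite -(pmulr_rgt0 _ (ltr0n R 2)); exact: lt_le_trans lex.
by move=> y Ey; apply: le_trans lex; exact: (ub_le_sup supE.2 Ey).
Qed.

(** The last bound follows from the previous one: putting [a] in place of row [k] multiplies the
    determinant by the [k]-th coordinate of [a] in the basis [A]. *)
Lemma near_max_basis n (S : set 'rV[R]_n) (D : R) :
  (forall u : 'cV[R]_n, u != 0 -> exists2 x, S x & x *m u != 0) ->
  (forall B : 'M[R]_n, (forall i, S (row i B)) -> `|\det B| <= D) ->
  exists A : 'M[R]_n, [/\ forall i, S (row i A), A \in unitmx,
    (forall B : 'M[R]_n, (forall i, S (row i B)) -> `|\det B| <= 2 * `|\det A|) &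
    (forall a k, S a -> `|(a *m invmx A) 0 k| <= 2)].
Proof.
move=> spS bS; have [A0 [SA0 uA0]] := unitmx_of_spanning spS.
pose E := [set `|\det B| | B in [set B : 'M[R]_n | forall i, S (row i B)]].
have A0E : E `|\det A0| by exists A0.
have A0_gt0 : 0 < `|\det A0| by rewrite normr_gt0 -unitfE -unitmxE.
have [|_ [[A SA <-] A_gt0 maxE]] := near_maximizer (D := D) A0E A0_gt0.
  by move=> _ [B SB <-]; exact: bS.
have uA : A \in unitmx by rewrite unitmxE unitfE -normr_gt0.
have maxA (B : 'M[R]_n) : (forall i, S (row i B)) -> `|\det B| <= 2 * `|\det A|.
  by move=> SB; apply: maxE; exists B.
exists A; split=> // a k Sa.
rewrite -(ler_pM2r A_gt0) -normrM -det_replace_row//; apply: maxA => i.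
rewrite rowE; have [->|ik] := eqVneq i k; rewrite -rowE.
  suff -> : row k (\matrix_(i, j) (if i == k then a 0 j else A i j)) = a by [].
  by apply/rowP => j; rewrite !mxE eqxx.
suff -> : row i (\matrix_(i, j) (if i == k then a 0 j else A i j)) = row i A by [].
by apply/rowP => j; rewrite !mxE (negbTE ik).
Qed.

(** Matrix determinant lemma, by eliminating either diagonal block of the same block matrix. *)
Lemma det_rank1_update n (M : 'M[R]_n) (c : 'cV[R]_n) (r : 'rV[R]_n) :
  M \in unitmx -> \det (M + c *m r) = \det M * (1 + (r *m invmx M *m c) 0 0).
Proof.
move=> uM; transitivity (\det (block_mx 1%:M (- r) c M)).
  have -> : block_mx 1%:M (- r) c M =
      block_mx 1%:M 0 c 1%:M *m block_mx 1%:M (- r) 0 (M + c *m r).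
    rewrite mulmx_block !mul1mx !mul0mx !mulmx1 !addr0 mulmxN.
    by rewrite (addrC M) addKr.
  by rewrite det_mulmx det_lblock det_ublock !det1 !mul1r.
have -> : block_mx 1%:M (- r) c M =
    block_mx 1%:M (- (r *m invmx M)) 0 1%:M *m
    block_mx (1%:M + r *m invmx M *m c) 0 c M.
  rewrite mulmx_block !mul1mx !mul0mx !add0r !mulNmx addrK.
  by rewrite -mulmxA mulVmx// mulmx1.
by rewrite det_mulmx det_ublock det_lblock !det1 !mul1r det_mx11 !mxE eqxx mulr1n mulrC.
Qed.

(** Induction on [n], passing to the Schur complement of the top-left entry. *)
Lemma cholesky n (M : 'M[R]_n) : M^T = M ->
  (forall x : 'rV[R]_n, x != 0 -> 0 < (x *m M *m x^T) 0 0) ->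
  exists L : 'M[R]_n, M = L *m L^T.
Proof.
elim: n M => [|n IH] M symM posM; first by exists 0; rewrite [LHS]thinmx0 [RHS]thinmx0.
pose M' : 'M[R]_(1 + n) := M.
pose m := M' 0 0; pose r := ursubmx M'; pose N := drsubmx M'.
have ulE : ulsubmx M' = m%:M.
  by rewrite [LHS]mx11_scalar !mxE; congr (M _ _)%:M; apply: val_inj.
have symM' : M'^T = M' := symM.
have posM' (x : 'rV[R]_(1 + n)) : x != 0 -> 0 < (x *m M' *m x^T) 0 0 by exact: posM.
have dlE : dlsubmx M' = r^T by rewrite /r trmx_ursub symM'.
have NT : N^T = N by rewrite /N trmx_drsub symM'.
have M'E : M' = block_mx m%:M r r^T N by rewrite -ulE -dlE submxK.
have m_gt0 : 0 < m.
  have := posM (delta_mx 0 0); rewrite -rowE.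
  have -> : row 0 M *m (delta_mx 0 0)^T = col 0 (row 0 M) by rewrite trmx_delta colE.
  rewrite !mxE; apply; apply/eqP => /matrixP/(_ 0 0); rewrite !mxE eqxx => /eqP.
  by rewrite oner_eq0.
have m_neq0 : m != 0 by rewrite gt_eqF.
have [||L SL] := IH (N - m^-1 *: (r^T *m r)).
- by rewrite linearB linearZ /= trmx_mul trmxK NT.
- move=> y y0.
  (* The first entry of [z] completes the square: the form of [M] at [z] is the form of the Schur
     complement at [y]. *)
  pose z : 'rV[R]_(1 + n) := row_mx (- m^-1 *: (y *m r^T)) y.
  have : z != 0.
    apply: contraNneq y0 => z0.
    by rewrite -(row_mxKr (- m^-1 *: (y *m r^T)) y) -/z z0 raddf0.
  move=> /posM'; rewrite M'E /z mul_row_block tr_row_mx mul_row_col.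
  rewrite mul_mx_scalar scalerA mulrN divff// scaleN1r addNr mul0mx add0r.
  rewrite -scalemxAl mulmxBr -scalemxAr mulmxA addrC scaleNr; exact.
pose s := Num.sqrt m.
have ss : s * s = m by rewrite -expr2 sqr_sqrtr// ltW.
have s0 : s != 0 by apply: contraNneq m_neq0 => s0; rewrite -ss s0 mul0r.
exists (block_mx s%:M 0 (s^-1 *: r^T) L : 'M[R]_(1 + n)).
suff : M' = block_mx s%:M 0 (s^-1 *: r^T) L *m (block_mx s%:M 0 (s^-1 *: r^T) L)^T by [].
rewrite M'E tr_block_mx mulmx_block !tr_scalar_mx trmx0 !mulmx0 !mul0mx !addr0.
rewrite -scalar_mxM ss mul_scalar_mx mul_mx_scalar linearZ /= trmxK !scalerA divff// !scale1r.
by rewrite -scalemxAl -scalemxAr scalerA -invfM ss -SL addrC subrK.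
Qed.

End linear_algebra.

(** * Nearly optimal designs *)

Lemma expR1_le4 (R : realType) : expR 1 <= 4 :> R.
Proof.
have e2 : expR (2^-1) <= 2 :> R.
  have := expR_ge1Dx (- 2^-1 : R); rewrite expRN => h2.
  have e0 := expR_gt0 (2^-1 : R).
  by have := ler_wpM2r (ltW e0) h2; rewrite mulVf ?gt_eqF//; lra.
have -> : expR 1 = expR (2^-1) ^+ 2 :> R by rewrite -expRM_natl; congr expR; field.
by rewrite expr2; have e0 := expR_gt0 (2^-1 : R); nra.
Qed.

Section design.
Context (R : realType) (n : nat) (V : set 'rV[R]_n).

(** The second-moment matrices of finitely supported probability measures on [V]. *)
Definition is_design (M : 'M[R]_n) := exists m (c : 'I_m -> R) (l : 'I_m -> 'rV[R]_n),
  [/\ forall i, 0 <= c i, \sum_i c i = 1, forall i, V (l i) &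
      M = \sum_i c i *: ((l i)^T *m l i)].

(* Cauchy-Binet, written with repetitions: each n-subset of the indices appears n! times. *)
Lemma det_sum_rank1 m (c : 'I_m -> R) (l : 'I_m -> 'rV[R]_n) :
  n`!%:R * \det (\sum_i c i *: ((l i)^T *m l i)) =
  \sum_(f : {ffun 'I_n -> 'I_m})
    (\prod_k c (f k)) * (\det (\matrix_k l (f k))) ^+ 2.
Proof.
pose W (f : {ffun 'I_n -> 'I_m}) := \prod_k c (f k).
pose D (f : {ffun 'I_n -> 'I_m}) : 'M[R]_n := \matrix_k l (f k).
pose G f := W f * ((\prod_k D f k k) * \det (D f)).
have -> : \det (\sum_i c i *: ((l i)^T *m l i)) = \sum_f G f.
  rewrite /(\det _).
  transitivity (\sum_(s : 'S_n) \sum_(f : {ffun 'I_n -> 'I_m})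
      (-1) ^+ s * (W f * ((\prod_k D f k k) * \prod_k D f k (s k)))).
    apply: eq_bigr => s _; rewrite -big_distrr /=; congr (_ * _).
    transitivity (\prod_k \sum_i c i * (l i 0 k * l i 0 (s k))).
      apply: eq_bigr => k _; rewrite summxE; apply: eq_bigr => i _.
      by rewrite !mxE big_ord1 !mxE.
    rewrite bigA_distr_bigA; apply: eq_bigr => f _.
    rewrite !big_split /=; congr (_ * (_ * _)); apply: eq_bigr => k _;
    by rewrite /D mxE.
  rewrite exchange_big; apply: eq_bigr => f _.
  rewrite /G /determinant mulrA big_distrr /=; apply: eq_bigr => s _.
  by rewrite !mulrA; congr (_ * _); rewrite -!mulrA mulrC !mulrA.
pose h (s : 'S_n) (f : {ffun 'I_n -> 'I_m}) : {ffun 'I_n -> 'I_m} := [ffun k => f (s k)].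
have hbij s : bijective (h s).
  by exists (h s^-1%g) => f; apply/ffunP => k; rewrite !ffunE ?permKV ?permK.
have WE s f : W (h s f) = W f.
  by rewrite /W [RHS](reindex_inj (@perm_inj _ s)); apply: eq_bigr => k _; rewrite ffunE.
have DE s f : D (h s f) = row_perm s (D f).
  by apply/matrixP => i j; rewrite !mxE ffunE.
(* Averaging over the reindexings [h s]: the weight of [f] is unchanged, the determinant picks up
   the sign of [s], and the diagonal products assemble into a second determinant. *)
transitivity (\sum_(s : 'S_n) \sum_f G (h s f)).
  rewrite [RHS](eq_bigr (fun _ => \sum_f G f)).
    by rewrite sumr_const mulr_natl; congr (_ *+ _); rewrite -[LHS](card_Sn n); apply: eq_card.
  by move=> s _; rewrite [RHS](reindex (h s))//; exact: onW_bij.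
rewrite exchange_big; apply: eq_bigr => f _.
transitivity (W f * \det (D f) * \sum_(s : 'S_n) (-1) ^+ s * \prod_k (D f)^T k (s k)).
  rewrite big_distrr /=; apply: eq_bigr => s _.
  have -> : \prod_k (D f)^T k (s k) = \prod_k D (h s f) k k.
    by apply: eq_bigr => k _; rewrite DE !mxE.
  rewrite /G WE DE row_permE det_mulmx det_perm.
  have mulE (w a b e : R) : w * (a * (e * b)) = w * b * (e * a) by ring.
  exact: mulE.
by rewrite -/(\det (D f)^T) det_tr -mulrA -expr2.
Qed.

(** In the Cauchy-Binet sum every squared determinant is at most [d ^+ 2], and the weights add up to
    the [n]-th power of the total mass 1. *)
Lemma design_det_le (d : R) M :
  (forall B : 'M[R]_n, (forall i, V (row i B)) -> `|\det B| <= d) ->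
  is_design M -> n`!%:R * \det M <= d ^+ 2.
Proof.
move=> bV [m [c [l [c0 c1 Vl ->]]]]; rewrite det_sum_rank1.
have -> : d ^+ 2 = \sum_(f : {ffun 'I_n -> 'I_m}) (\prod_k c (f k)) * d ^+ 2.
  rewrite -big_distrl /= -(bigA_distr_bigA (fun=> c)).
  by rewrite prodr_const c1 expr1n mul1r.
apply: ler_sum => f _; apply: ler_wpM2l; first by apply: prodr_ge0.
rewrite -real_normK ?num_real// lerXn2r// ?nnegrE//.
  by apply: le_trans (bV (\matrix_k l (f k)) _) => // i; rewrite rowK.
by apply: bV => i; rewrite rowK.
Qed.

Lemma design_sym M : is_design M -> M^T = M.
Proof.
move=> [m [c [l [_ _ _ ->]]]]; rewrite raddf_sum; apply: eq_bigr => i _.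
by rewrite /= linearZ /= trmx_mul trmxK.
Qed.

(** The form at [x] is the sum of the [c i <x, l i>^2]; if it vanishes then so does [x *m M]. *)
Lemma design_posdef M : is_design M -> M \in unitmx ->
  forall x : 'rV[R]_n, x != 0 -> 0 < (x *m M *m x^T) 0 0.
Proof.
move=> [m [c [l [c0 _ _ ME]]]] uM x x0.
have E : (x *m M *m x^T) 0 0 = \sum_i c i * ((x *m (l i)^T) 0 0) ^+ 2.
  rewrite ME mulmx_sumr mulmx_suml summxE; apply: eq_bigr => i _.
  rewrite -scalemxAr -scalemxAl mxE; congr (_ * _).
  have -> : x *m ((l i)^T *m l i) *m x^T = (x *m (l i)^T) *m (x *m (l i)^T)^T.
    by rewrite trmx_mul trmxK !mulmxA.
  by move: (x *m _) => a; rewrite !mxE big_ord1 !mxE.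
have ge0 i : 0 <= c i * ((x *m (l i)^T) 0 0) ^+ 2 by rewrite mulr_ge0// sqr_ge0.
rewrite lt_neqAle E sumr_ge0 ?andbT//; apply: contraNneq x0 => /esym/eqP.
rewrite psumr_eq0// => /allP z.
suff xM : x *m M = 0 by rewrite -[x](mulmxK uM) xM mul0mx.
rewrite ME mulmx_sumr big1// => i _; rewrite -scalemxAr mulmxA.
have := z i (mem_index_enum _); rewrite mulf_eq0 sqrf_eq0 => /orP[/eqP->|/eqP xl].
  by rewrite scale0r.
by rewrite [x *m _]mx11_scalar xl mul_scalar_mx scale0r scaler0.
Qed.

Lemma design_mix M (v : 'rV[R]_n) (t : R) : is_design M -> V v -> 0 <= t <= 1 ->
  is_design ((1 - t) *: M + t *: (v^T *m v)).
Proof.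
move=> [m [c [l [c0 c1 Vl ->]]]] Vv /andP[t0 t1].
exists m.+1, (fun i => if unlift ord0 i is Some k then (1 - t) * c k else t),
  (fun i => if unlift ord0 i is Some k then l k else v); split.
- by move=> i; case: unliftP => [k _|_] //; rewrite mulr_ge0// subr_ge0.
- rewrite big_ord_recl unlift_none; under eq_bigr do rewrite liftK.
  by rewrite -big_distrr /= c1 mulr1 addrC subrK.
- by move=> i; case: unliftP.
- rewrite big_ord_recl !unlift_none; under [in RHS]eq_bigr do rewrite !liftK -scalerA.
  by rewrite -scaler_sumr addrC.
Qed.

(** Provides a design of positive determinant, from which a near maximizer can be extracted. *)
Lemma design_unif : (0 < n)%N -> (forall i, V (row i 1%:M)) ->
  is_design (n%:R^-1 *: 1%:M).
Proof.
move=> n0 V1; exists n, (fun=> n%:R^-1), (fun i => row i 1%:M); split=> //.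
  by rewrite sumr_const card_ord -[LHS]mulr_natl divff// pnatr_eq0 -lt0n.
rewrite -scaler_sumr; congr (_ *: _); apply/matrixP => i j.
rewrite summxE (bigD1 i)//= big1 ?addr0; last first.
  by move=> k ki; rewrite !mxE big_ord1 !mxE (negbTE ki) mul0r.
by rewrite !mxE big_ord1 !mxE eqxx mul1r.
Qed.

(* Kiefer-Wolfowitz: mixing the mass 1/(n+1) at v into a near D-optimal design M
   multiplies the determinant by (n/(n+1))^n (1 + v M^-1 v^T / n), which is at most 2. *)
Lemma near_optimal_design (d : R) : (0 < n)%N ->
  (forall i, V (row i 1%:M)) ->
  (forall B : 'M[R]_n, (forall i, V (row i B)) -> `|\det B| <= d) ->
  exists M, [/\ is_design M, 0 < \det M &
    forall v, V v -> (v *m invmx M *m v^T) 0 0 <= 8 * n%:R].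
Proof.
move=> n0 V1 bV.
have nR0 : 0 < n%:R :> R by rewrite ltr0n.
pose E := [set \det M | M in is_design].
have E0 : E (\det (n%:R^-1 *: 1%:M : 'M[R]_n)).
  by exists (n%:R^-1 *: 1%:M) => //; exact: design_unif.
have det0 : 0 < \det (n%:R^-1 *: 1%:M : 'M[R]_n).
  by rewrite detZ det1 mulr1 exprn_gt0// invr_gt0.
have [|_ [[M dM <-] M0 maxM]] := near_maximizer (D := d ^+ 2) E0 det0.
  move=> _ [M dM <-].
  have [M0|M0] := ltP (\det M) 0; first by rewrite (le_trans (ltW M0))// sqr_ge0.
  apply: le_trans (design_det_le bV dM); rewrite ler_peMl//.
  by rewrite ler1n fact_gt0.
exists M; split=> // v Vv.
pose t : R := n.+1%:R^-1.
have n10 : n.+1%:R != 0 :> R by rewrite pnatr_eq0.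
have t01 : 0 <= t <= 1 by rewrite invr_ge0 ler0n /= invf_le1 ?ltr0n// ler1n.
have tE : 1 - t = n%:R / n.+1%:R by rewrite /t -addn1 natrD; field; rewrite natr1.
have t_gt0 : 0 < 1 - t by rewrite tE divr_gt0// ltr0n.
have := maxM _ (ex_intro2 _ _ _ (design_mix dM Vv t01) erefl).
set q := (v *m invmx M *m v^T) 0 0.
have uM : M \in unitmx by rewrite unitmxE unitfE gt_eqF.
have -> : (1 - t) *: M + t *: (v^T *m v) = (1 - t) *: (M + (n%:R^-1 *: v^T) *m v).
  rewrite scalerDr -scalemxAl scalerA tE /t; congr (_ + _ *: _).
  by field; rewrite ?natr1 ?nat1r ?n10 ?gt_eqF.
rewrite detZ det_rank1_update// -scalemxAr mxE -/q mulrCA mulrC (ler_pM2r M0).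
rewrite -(ler_pM2l (exprn_gt0 n (_ : 0 < (1 - t)^-1))) ?invr_gt0//.
rewrite mulrA -exprMn mulVf ?gt_eqF// expr1n mul1r.
(* This is [(1 + 1/n)^n <= e <= 4]; with the factor 2 of near-maximality it gives [1 + q/n <= 8]. *)
have e4 : ((1 - t)^-1) ^+ n <= 4.
  have h : (1 - t)^-1 <= expR n%:R^-1.
    by apply: le_trans _ (expR_ge1Dx _); rewrite tE invf_div -addn1 natrD;
    rewrite mulrDl divff ?gt_eqF// mul1r lexx.
  apply: (@le_trans _ _ (expR 1)).
    rewrite (_ : expR 1 = expR (n%:R^-1) ^+ n).
      by apply: lerXn2r => //; rewrite nnegrE ?invr_ge0 ?(ltW t_gt0)// expR_ge0.
    by rewrite -expRM_natl mulfV ?gt_eqF.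
  exact: expR1_le4.
move=> h.
have : 1 + n%:R^-1 * q <= 8 by apply: le_trans h _; nra.
move=> h2; rewrite -ler_pdivrMr// mulrC; lra.
Qed.

End design.

(** * Helly's theorem for half-spaces *)

Section helly.
Context (R : realType).

Lemma dot_rV_suml n (T : finType) (Q : pred T) (c : T -> R) (y : T -> 'rV[R]_n) g :
  dot_rV (\sum_(i | Q i) c i *: y i) g = \sum_(i | Q i) c i * dot_rV (y i) g.
Proof.
rewrite dot_rVE mulmx_suml summxE; apply: eq_bigr => i _.
by rewrite -scalemxAl mxE -dot_rVE.
Qed.

Lemma dot_rVZl n k (x u : 'rV[R]_n) : dot_rV (k *: x) u = k * dot_rV x u.
Proof. by rewrite !dot_rVE -scalemxAl mxE. Qed.

Lemma dot_rVDl n (x y u : 'rV[R]_n) : dot_rV (x + y) u = dot_rV x u + dot_rV y u.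
Proof. by rewrite !dot_rVE mulmxDl mxE. Qed.

Lemma dot_rVBl n (x y u : 'rV[R]_n) : dot_rV (x - y) u = dot_rV x u - dot_rV y u.
Proof. by rewrite -scaleN1r dot_rVDl dot_rVZl mulN1r. Qed.

Lemma dot_rVZr n k (x u : 'rV[R]_n) : dot_rV x (k *: u) = k * dot_rV x u.
Proof. by rewrite !dot_rVE linearZ /= -scalemxAr mxE. Qed.

Lemma dot_rV0l n (u : 'rV[R]_n) : dot_rV 0 u = 0.
Proof. by rewrite dot_rVE mul0mx mxE. Qed.

Lemma continuous_dot_rV n (u : 'rV[R]_n) : continuous (fun x : 'rV[R]_n => dot_rV x u).
Proof.
apply: continuous_big => [|i _]; first exact: add_continuous.
move=> x; apply: (@cvgM R _ _ (nbhs_filter x)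
  (fun y : 'rV[R]_n => y ord0 i : R^o) (cst (u ord0 i)) (x ord0 i) (u ord0 i)).
    exact: (@coord_continuous R 1 n ord0 i x).
exact: cvg_cst.
Qed.

(* Radon: an affine dependence among more than n + 1 points splits them into two
   groups whose convex hulls meet in z; constraint j holds at z because j is
   violated by at most the point y j, which lies in only one of the two groups. *)
Lemma radon_halfspaces n m (g : 'I_m -> 'rV[R]_n) (b : 'I_m -> R) (y : 'I_m -> 'rV[R]_n) :
  (n.+1 < m)%N -> (forall i j, i != j -> dot_rV (y i) (g j) <= b j) ->
  exists z, forall j, dot_rV z (g j) <= b j.
Proof.
move=> nm yg.
(* A row in the kernel of [X] is a linear dependence among the vectors [(1, y i)], that is an affine
   dependence among the [y i]. *)
pose X : 'M[R]_(m, 1 + n) := \matrix_i row_mx 1%:M (y i).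
have : kermx X != 0.
  rewrite kermx_eq0 /row_free; apply: contraTneq nm => <-.
  by rewrite -leqNgt rank_leq_col.
move=> /eqP/matrixP/existsNP[k /existsNP[l]]; rewrite [X in _ = X]mxE => /eqP kl.
pose v i := kermx X k i.
have vX : row k (kermx X) *m X = 0 by rewrite -row_mul mulmx_ker row0.
have vXE : row k (kermx X) *m X = \sum_i v i *: row_mx 1%:M (y i).
  by rewrite mulmx_sum_row; apply: eq_bigr => i _; rewrite mxE rowK.
have v0 : \sum_i v i = 0.
  have := congr1 (fun A => lsubmx A 0 0) (etrans (esym vXE) vX).
  rewrite raddf_sum summxE !mxE => h; rewrite -[RHS]h; apply: eq_bigr => i _.
  by rewrite /= scale_row_mx row_mxKl !mxE mulr1.
have vy : \sum_i v i *: y i = 0.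
  have := congr1 rsubmx (etrans (esym vXE) vX).
  rewrite raddf_sum raddf0 => h; rewrite -[RHS]h; apply: eq_bigr => i _.
  by rewrite /= scale_row_mx row_mxKr.
pose p := \sum_(i | 0 < v i) v i.
have pE : \sum_(i | ~~ (0 < v i)) - v i = p.
  apply/eqP; rewrite sumrN eqr_oppLR -addr_eq0 addrC.
  by move: v0; rewrite (bigID (fun i => 0 < v i)) /= => ->.
pose z0 := \sum_(i | 0 < v i) v i *: y i.
have z0E : \sum_(i | ~~ (0 < v i)) (- v i) *: y i = z0.
  apply/eqP; under eq_bigr do rewrite scaleNr.
  rewrite sumrN eqr_oppLR -addr_eq0 addrC.
  by move: vy; rewrite (bigID (fun i => 0 < v i)) /= => ->.
have p_ge0 : 0 <= p by apply: sumr_ge0 => i /ltW.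
have p_gt0 : 0 < p.
  rewrite lt_neqAle p_ge0 andbT; apply: contraNneq kl => p0.
  have [vl|vl] := ltP 0 (v l).
    move/esym/eqP: p0; rewrite psumr_eq0; last by move=> i /ltW.
    by move=> /allP/(_ l (mem_index_enum _)); rewrite vl.
  have : \sum_(i | ~~ (0 < v i)) - v i = 0 by rewrite pE -p0.
  move/eqP; rewrite psumr_eq0; last by move=> i; rewrite -leNgt oppr_ge0.
  by move=> /allP/(_ l (mem_index_enum _)); rewrite -leNgt vl oppr_eq0.
exists (p^-1 *: z0) => j; rewrite dot_rVZl mulrC ler_pdivrMr//.
have [vj|vj] := ltP 0 (v j).
- rewrite -z0E -pE dot_rV_suml mulr_sumr; apply: ler_sum => i; rewrite -leNgt => vi.
  rewrite mulrC ler_wpM2r ?oppr_ge0//; apply: yg.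
  by apply: contraTneq vj => <-; rewrite -leNgt.
- rewrite dot_rV_suml mulr_sumr; apply: ler_sum => i vi.
  rewrite mulrC ler_wpM2r ?(ltW vi)//; apply: yg.
  by apply: contraTneq vi => ->; rewrite -leNgt.
Qed.

(** Induction on the number of constraints: solutions of the subsystems that omit one constraint are
    the points to which Radon's argument applies. *)
Lemma helly_halfspaces n (T : finType) (g : T -> 'rV[R]_n) (b : T -> R) :
  (forall J : {set T}, (#|J| <= n.+1)%N ->
    exists x, forall t, t \in J -> dot_rV x (g t) <= b t) ->
  exists x, forall t, dot_rV x (g t) <= b t.
Proof.
move=> H.
suff K k (J : {set T}) : (#|J| <= k)%N ->
    exists x, forall t, t \in J -> dot_rV x (g t) <= b t.
  by have [x xP] := K _ [set: T]%SET (leqnn _); exists x => t; apply: xP; rewrite inE.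
elim: k J => [J J0|k IH J Jk]; first by apply: H; rewrite (leq_trans J0).
have [Jn|nJ] := leqP #|J| n.+1; first exact: H.
have /choice[y yP] (i : 'I_#|J|) : exists y, forall t, t \in (J :\ enum_val i)%SET ->
    dot_rV y (g t) <= b t.
  apply: IH; rewrite -ltnS (leq_trans _ Jk)//.
  by rewrite [in ltnRHS](cardsD1 (enum_val i)) enum_valP.
have [|z zP] := @radon_halfspaces n #|J| (g \o enum_val) (b \o enum_val) y nJ.
  move=> i j ij; apply: yP; rewrite !inE enum_valP andbT.
  by rewrite (inj_eq enum_val_inj) eq_sym.
by exists z => t tJ; have := zP (enum_rank_in tJ t); rewrite /= enum_rankK_in.
Qed.

(** Compactness leaves finitely many constraints. Together with [<x, w> >= c] they are infeasible,
    so by Helly some [n + 1] of these conditions are. Since 0 satisfies all the others,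
    [<x, w> >= c] is among them, which leaves at most [n] from the family. *)
Lemma helly_functional n (I : Type) (a : I -> 'rV[R]_n) (w : 'rV[R]_n) (c r : R) :
  0 < c ->
  (forall x, (forall i, dot_rV x (a i) <= 1) -> `|x| < r /\ dot_rV x w < c) ->
  exists m (j : 'I_m -> I), (m <= n)%N /\
    forall x, (forall k, dot_rV x (a (j k)) <= 1) -> dot_rV x w < c.
Proof.
move=> c0 Pb.
(* [X] misses the polyhedron, so the open complements of the half-spaces cover it. The sphere is
   included to control points outside the ball. *)
pose X := [set x : 'rV[R]_n | `|x| <= r] `&`
  ([set x : 'rV[R]_n | `|x| = r] `|` [set x : 'rV[R]_n | c <= dot_rV x w]).
have r0 : 0 < r.
  by have [] := Pb 0 => [i|]; rewrite ?dot_rV0l ?ler01// normr0.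
have ctn : continuous (fun x : 'rV[R]_n => `|x|) by exact: norm_continuous.
have ctw := @continuous_dot_rV n w.
have cX : compact X.
  apply: bounded_closed_compact.
    by exists r; split; [exact: num_real|move=> M rM x [/= xr _]; exact: le_trans xr (ltW rM)].
  apply: closedI.
    apply: (@preimage_closed _ _ _ [set t : R | t <= r]); last exact: closed_le.
    by move=> x _; exact: ctn.
  apply: closedU.
    apply: (@preimage_closed _ _ _ [set t : R | t = r]); last exact: closed_eq.
    by move=> x _; exact: ctn.
  apply: (@preimage_closed _ _ _ [set t : R | c <= t]); last exact: closed_ge.
  by move=> x _; exact: ctw.
rewrite compact_cover in cX.
have [i _|x [/= xr Xx]|D _ XD] := cX {classic I} setT (fun i => [set x | 1 < dot_rV x (a i)]).
- apply: (@open_comp _ _ _ [set t : R | 1 < t]); last exact: open_gt.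
  by move=> x _; exact: continuous_dot_rV.
- have [i xi] : exists i, ~ dot_rV x (a i) <= 1.
    apply/existsNP => xP; have [xr' xc] := Pb x xP.
    by case: Xx => /= [E|]; [rewrite E ltxx in xr'|rewrite leNgt xc].
  by exists i => //=; rewrite ltNge; exact/negP.
(* A feasible point outside the ball would shrink to a point of the sphere, still feasible because 0
   is; but the chosen constraints exclude the sphere. *)
have {XD}DP x : (forall i : D, dot_rV x (a (val i)) <= 1) -> dot_rV x w < c.
  move=> xD; rewrite ltNge; apply/negP => cx.
  have [xr|rx] := leP `|x| r.
    have [|i /= iD] := XD x; first by split=> //; right.
    by rewrite ltNge (xD [` iD]%fset).
  have x0 : 0 < `|x| by exact: lt_trans rx.
  have s0 : 0 <= r / `|x| by rewrite divr_ge0// ltW.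
  have s1 : r / `|x| <= 1 by rewrite ler_pdivrMr// mul1r ltW.
  have nr : `|(r / `|x|) *: x| = r.
    by rewrite normrZ (ger0_norm s0) divfK// gt_eqF.
  have [|i /= iD] := XD ((r / `|x|) *: x); first by split=> /=; [rewrite nr|left].
  rewrite dot_rVZl ltNge => /negP; apply.
  have := xD [` iD]%fset; rewrite /=; set d := dot_rV _ _ => d1.
  have [d0|d0] := leP d 0; first by rewrite (le_trans _ ler01)// mulr_ge0_le0.
  by rewrite -[1]mulr1 ler_pM// ltW.
(* [None] encodes the constraint [<x, w> >= c]. *)
pose J' (J : {set option D}) := [set t | Some t \in J]%SET.
have [H|] := pselect (forall J : {set option D}, (#|J| <= n.+1)%N ->
    exists x, forall t, t \in J ->
    dot_rV x (if t is Some i then a (val i) else - w) <= (if t is Some i then 1 else - c)).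
  have [x xP] := helly_halfspaces H.
  have := DP x (fun i => xP (Some i)); have := xP None.
  by rewrite -scaleN1r dot_rVZr mulN1r lerN2 => /le_lt_trans h /h; rewrite ltxx.
move=> /existsNP[J /not_implyP[Jn JN]].
have NJ : None \in J.
  apply/negP => NJ; apply: JN; exists 0 => t tJ; rewrite dot_rV0l.
  by case: t tJ => [i _|/NJ//]; exact: ler01.
have Some_injD : injective (@Some D) by move=> ? ? [].
have cJ' : (#|J' J| <= n)%N.
  rewrite -ltnS; apply: leq_trans Jn.
  rewrite (cardsD1 None J) NJ add1n ltnS -(card_imset _ Some_injD).
  apply: subset_leq_card; apply/fintype.subsetP => _ /imsetP[t + ->].
  by rewrite !inE.
exists #|J' J|, (fun k => val (enum_val k)); split=> // x xP.
rewrite ltNge; apply/negP => cx; apply: JN; exists x => -[i iJ|_].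
  have iJ' : i \in J' J by rewrite inE.
  by have := xP (enum_rank_in iJ' i); rewrite enum_rankK_in.
by rewrite -scaleN1r dot_rVZr mulN1r lerN2.
Qed.

End helly.

(** * Centering a polyhedron of finite volume *)

Section center.
Context (R : realType).
Local Notation mu n := (lebesgue_measure_rV R n).

Lemma closed_polyhedron n (I : Type) (u : I -> 'rV[R]_n) (b : I -> R) :
  closed [set x | forall i, dot_rV x (u i) <= b i].
Proof.
rewrite (_ : [set _ | _] = \bigcap_(i in setT) [set x | dot_rV x (u i) <= b i]).
  apply: closed_bigI => i _.
  apply: (@preimage_closed _ _ _ [set t : R | t <= b i]); last exact: closed_le.
  by move=> x _; exact: continuous_dot_rV.
by apply/seteqP; split => [x xP i _|x xP i]; exact: xP.
Qed.

Lemma measurable_polyhedron n (I : Type) (u : I -> 'rV[R]_n) (b : I -> R) :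
  measurable [set x | forall i, dot_rV x (u i) <= b i].
Proof. by apply: (@closed_measurable_rV R n); exact: closed_polyhedron. Qed.

Lemma le_lebesgue_measure_rV n (A B : set 'rV[R]_n) :
  measurable A -> measurable B -> A `<=` B -> (mu n A <= mu n B)%E.
Proof. by move=> mA mB; apply: (le_measure (mu n)); exact: mem_set. Qed.

Lemma not_in_hyperplane n (A : set 'rV[R]_n) (u : 'rV[R]_n) b :
  measurable A -> (0 < mu n A)%E -> u != 0 -> exists2 x, A x & dot_rV x u != b.
Proof.
move=> mA A0 u0; apply: contrapT => H.
move: A0; apply/negP; rewrite -leNgt -(lebesgue_measure_rV_hyperplane b u0).
apply: le_lebesgue_measure_rV => //.
  apply: (@closed_measurable_rV R n).
  apply: (@preimage_closed _ _ _ [set t : R | t = b]); last exact: closed_eq.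
  by move=> x _; exact: continuous_dot_rV.
move=> x Ax /=; apply: contrapT => xb; apply: H; exists x => //; exact/eqP.
Qed.

Lemma measurable_cube n (T : 'M[R]_n) (c l : 'rV[R]_n) (h : R) :
  measurable [set x : 'rV[R]_n | forall i, l 0 i <= (x *m T + c) 0 i <= l 0 i + h].
Proof.
pose B i : set (measurableTypeR R) := `[l 0 i, l 0 i + h]%classic.
rewrite (_ : [set _ | _] = (fun x : 'rV[R]_n => x *m T + c) @^-1`
    [set x | forall i, B i (x ord0 i)]); last first.
  by apply/seteqP; split=> x xP i; have := xP i; rewrite /B /= in_itv.
rewrite -[X in measurable X]setTI; apply: measurable_affine_rV => //.
by apply: measurable_box_rV => i; exact: measurable_itv.
Qed.

Lemma lebesgue_measure_rV_cube n (T : 'M[R]_n) (c l : 'rV[R]_n) (h : R) :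
  T \in unitmx -> 0 <= h ->
  mu n [set x : 'rV[R]_n |
    forall i, l 0 i <= (x *m T + c) 0 i <= l 0 i + h] = (`|\det T|^-1 * h ^+ n)%:E.
Proof.
move=> uT h0.
rewrite (_ : [set _ | _] = [set x : 'rV[R]_n |
    forall i, `[l 0 i, l 0 i + h]%classic ((x *m T + c)%R ord0 i)]); last first.
  by apply/seteqP; split=> x xP i; have := xP i; rewrite /= in_itv.
rewrite (lebesgue_measure_rV_parallelepiped c (B := fun i => `[l 0 i, l 0 i + h]%classic))//.
rewrite (eq_bigr (fun=> h%:E)) => [|i _].
  by rewrite prodEFin prodr_const card_ord EFinM.
rewrite /= lebesgue_measure_itv/= lte_fin ltrDl; case: ltP => [_|h0'].
  by rewrite -EFinB addrAC subrr add0r.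
by congr EFin; apply/eqP; rewrite eq_le h0 h0'.
Qed.

Section simplex.
Variables (n : nat) (I : Type) (u : I -> 'rV[R]_n) (b : I -> R).
Let P := [set x : 'rV[R]_n | forall i, dot_rV x (u i) <= b i].
Hypotheses (n0 : (0 < n)%N) (P0 : (0 < mu n P)%E) (Poo : (mu n P < +oo)%E).

(** Homogenization: the determinant of [n + 1] lifted points is, up to sign, [n!] times the volume
    of their simplex, and coordinates in a basis of lifted points are barycentric coordinates. *)
Let S := [set row_mx 1%:M x | x in P] : set 'rV[R]_(1 + n).

(** The parallelepiped at [x0] spanned by the edges scaled by [1/n] lies in the simplex, hence in
    [P], and has volume [|det X| / n^n]. *)
Lemma simplex_det_le (X : 'M[R]_(1 + n)) : (forall i, S (row i X)) ->
  `|\det X| <= n%:R ^+ n * fine (mu n P).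
Proof.
move=> SX.
have /choice[y yP] i : exists y, P y /\ row_mx 1%:M y = row i X.
  by have [y Py yX] := SX i; exists y.
pose x0 := y (lshift n 0); pose Y := \matrix_k y (rshift 1 k).
pose D : 'M[R]_n := \matrix_k (y (rshift 1 k) - x0).
have XE : X = block_mx 1%:M x0 (const_mx 1) Y.
  apply/row_matrixP => i; have [_ <-] := yP i; case: (split_ordP i) => k ->.
    by rewrite /block_mx rowKu row_row_mx !ord1 !row_id.
  rewrite /block_mx rowKd row_row_mx /Y rowK; congr row_mx.
  by apply/rowP => j; rewrite !mxE !ord1.
have detX : \det X = \det D.
  have <- : \det (block_mx 1%:M 0 (const_mx (-1)) 1%:M *m X) = \det X.
    by rewrite det_mulmx det_lblock !det1 !mul1r.
  rewrite XE mulmx_block !mul1mx !mul0mx !mulmx1 !addr0.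
  have -> : const_mx (-1) + const_mx 1 = 0 :> 'M[R]_(n, 1).
    by apply/matrixP => i j; rewrite !mxE addNr.
  rewrite det_ublock det1 mul1r; congr (\det _); apply/matrixP => i j.
  by rewrite !mxE big_ord1 !mxE mulN1r addrC.
rewrite detX; have [->|dD] := eqVneq (\det D) 0.
  by rewrite normr0 mulr_ge0 ?exprn_ge0// fine_ge0.
have uD : D \in unitmx by rewrite unitmxE unitfE.
have ni0 : 0 <= n%:R^-1 :> R by rewrite invr_ge0.
have nn0 : n%:R != 0 :> R by rewrite pnatr_eq0 -lt0n.
pose Q := [set x : 'rV[R]_n | forall i,
  (0 : 'rV[R]_n) 0 i <= (x *m invmx D + - (x0 *m invmx D)) 0 i <= (0 : 'rV[R]_n) 0 i + n%:R^-1].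
have QE : mu n Q = (`|\det (invmx D)|^-1 * n%:R^-1 ^+ n)%:E.
  by apply: lebesgue_measure_rV_cube => //; rewrite unitmx_inv.
have QP : Q `<=` P.
  move=> x xQ i; set t := x *m invmx D + - (x0 *m invmx D) in xQ.
  have xE : x = x0 + t *m D.
    by rewrite /t mulmxDl mulNmx !mulmxKV// addrC subrK.
  have {}xE : x = (1 - \sum_k t 0 k) *: x0 + \sum_k t 0 k *: y (rshift 1 k).
    rewrite xE mulmx_sum_row scalerBl scale1r -addrA; congr (_ + _).
    rewrite scaler_suml addrC -sumrB; apply: eq_bigr => k _.
    by rewrite rowK scalerBr.
  have t_ge0 k : 0 <= t 0 k by have /andP[+ _] := xQ k; rewrite mxE.
  have t1 : \sum_k t 0 k <= 1.
    apply: (@le_trans _ _ (\sum_(k < n) n%:R^-1)).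
      by apply: ler_sum => k _; have /andP[_] := xQ k; rewrite [in leRHS]mxE add0r.
    by rewrite sumr_const card_ord -[leLHS]mulr_natl mulfV.
  rewrite xE dot_rVDl dot_rVZl dot_rV_suml.
  have -> : b i = (1 - \sum_k t 0 k) * b i + \sum_k t 0 k * b i.
    by rewrite -mulr_suml -mulrDl subrK mul1r.
  apply: lerD; first by rewrite ler_wpM2l ?subr_ge0//; exact: (yP _).1.
  by apply: ler_sum => k _; rewrite ler_wpM2l//; exact: (yP _).1.
have : (mu n Q <= mu n P)%E.
  apply: le_lebesgue_measure_rV => //; last exact: measurable_polyhedron.
  exact: measurable_cube.
rewrite QE -[X in (_ <= X)%E]fineK ?ge0_fin_numE// lee_fin.
rewrite det_inv normfV invrK exprVn -ler_pdivlMr ?invr_gt0 ?exprn_gt0 ?ltr0n//.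
by rewrite invrK mulrC.
Qed.

(* With P inside the simplex coordinates [-2, 2] of a nearly maximal simplex, the
   reflected point o - (x - o) / k has nonnegative coordinates, so it lies in that simplex. *)
Lemma exists_center : exists o r,
  (forall x, P x -> P (o - (2 * n.+1%:R)^-1 *: (x - o))) /\
  (forall x, P x -> `|x| < r).
Proof.
have [x1 Px1] : exists x, P x.
  apply: contrapT => H; move: P0; rewrite (_ : P = set0) ?measure0 ?ltxx//.
  by apply/seteqP; split=> x // Px; apply: H; exists x.
(* The lifted points span: a nonzero functional vanishing on them would put [P] inside a hyperplane,
   or be a constant that vanishes on a nonempty set. *)
have [||X [SX uX _ coordX]] := @near_max_basis R _ S (n%:R ^+ n * fine (mu n P)).
- move=> v v0; apply: contrapT => H.
  have vE x : (row_mx 1%:M x *m v) 0 0 = v 0 0 + dot_rV x (dsubmx v)^T.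
    rewrite -{1}[v]vsubmxK mul_row_col mul1mx mxE dot_rVE trmxK; congr (_ + _).
    by rewrite mxE; congr (v _ _); exact: val_inj.
  have vx x : P x -> v 0 0 + dot_rV x (dsubmx v)^T = 0.
    move=> Px; apply: contrapT => /eqP h; apply: H; exists (row_mx 1%:M x); first by exists x.
    by apply: contraNneq h => e; rewrite -vE e mxE.
  have [d0|d0] := eqVneq (dsubmx v)^T 0.
    move/eqP: v0; apply; rewrite -[v]vsubmxK -[dsubmx v]trmxK d0 trmx0.
    have -> : usubmx v = 0.
      apply/rowP => j; rewrite !ord1 !mxE.
      have := vx _ Px1; rewrite d0 dot_rVE trmx0 mulmx0 mxE addr0 => <-.
      by congr (v _ _); exact: val_inj.
    by rewrite col_mx0.
  have [x Px /eqP] := not_in_hyperplane (- v 0 0) (measurable_polyhedron u b) P0 d0.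
  by apply; apply/eqP; rewrite -addr_eq0 addrC vx.
- exact: simplex_det_le.
have N0 : n.+1%:R != 0 :> R by rewrite pnatr_eq0.
have /choice[y yP] i : exists y, P y /\ row_mx 1%:M y = row i X.
  by have [y Py yX] := SX i; exists y.
have comb (g : 'rV[R]_(1 + n)) : rsubmx (g *m X) = \sum_i g 0 i *: y i.
  rewrite mulmx_sum_row raddf_sum; apply: eq_bigr => i _.
  by rewrite -(yP i).2 /= scale_row_mx row_mxKr.
have comb1 (g : 'rV[R]_(1 + n)) : (lsubmx (g *m X)) 0 0 = \sum_i g 0 i.
  rewrite mulmx_sum_row raddf_sum summxE; apply: eq_bigr => i _.
  by rewrite -(yP i).2 /= scale_row_mx row_mxKl !mxE mulr1.
pose beta x := row_mx 1%:M x *m invmx X.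
have bX x : beta x *m X = row_mx 1%:M x by rewrite /beta mulmxKV.
have b2 x i : P x -> `|beta x 0 i| <= 2 by move=> Px; apply: coordX; exists x.
pose o := n.+1%:R^-1 *: \sum_i y i.
exists o, (1 + \sum_i 2 * `|y i|); split; last first.
  move=> x Px; rewrite addrC ltr_pwDr//.
  have -> : x = \sum_i beta x 0 i *: y i by rewrite -comb bX row_mxKr.
  apply: le_trans (ler_norm_sum _ _ _) _; apply: ler_sum => i _.
  by rewrite normrZ ler_wpM2r// b2.
move=> x Px i.
pose k : R := 2 * n.+1%:R.
have k0 : 0 < k by rewrite mulr_gt0// ltr0n.
(* The barycentric coordinates of the reflected point. As [1/(n+1) = 2/k], they are nonnegative once
   [beta x 0 j <= 2], which dictates [k]. *)
pose g j := n.+1%:R^-1 * (1 + k^-1) - k^-1 * beta x 0 j.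
have k0' : k != 0 by rewrite gt_eqF.
have g0 j : 0 <= g j.
  have := b2 x j Px; rewrite ler_norml => /andP[_ h].
  have -> : g j = k^-1 * ((2 - beta x 0 j) + n.+1%:R^-1) by rewrite /g /k; field.
  by rewrite mulr_ge0 ?invr_ge0 ?(ltW k0)// addr_ge0 ?subr_ge0// invr_ge0.
have sb : \sum_j beta x 0 j = 1 by rewrite -comb1 bX row_mxKl mxE.
have sg : \sum_j g j = 1.
  rewrite sumrB -[X in _ - X]mulr_sumr sb sumr_const card_ord -[_ *+ _]mulr_natl add1n.
  by field; rewrite ?k0' ?natr1 ?nat1r ?N0.
have -> : o - k^-1 *: (x - o) = \sum_j g j *: y j.
  under eq_bigr do rewrite scalerBl -!scalerA.
  have xE : x = \sum_i beta x 0 i *: y i by rewrite -comb bX row_mxKr.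
  rewrite sumrB -!scaler_sumr -xE scalerA mulrC -scalerA -/o scalerDl scale1r scalerBr.
  by rewrite opprB addrA.
rewrite dot_rV_suml -[b i]mul1r -sg mulr_suml; apply: ler_sum => j _.
by rewrite ler_wpM2l//; exact: (yP j).1.
Qed.
End simplex.
End center.

(** * Volume of a corner *)

Section volume_of_corner.
Context (R : realType).
Local Notation mu n := (lebesgue_measure_rV R n).

(** Integer corners of the grid cells that cover a simplex of size [n]. A sum at most [n] already
    bounds each entry by [n], so the type ['I_n.+1] loses no cell. *)
Definition small_cells n := [set f : {ffun 'I_n -> 'I_n.+1} | (\sum_i f i <= n)%N]%SET.

(* Weight f by 2^(n - sum f), which is at least 1 on small_cells; the weights of all f
   sum to at most 2^n (1 + 1/2 + 1/4 + ...)^n. *)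
Lemma card_small_cells n : #|small_cells n|%:R <= 4 ^+ n :> R.
Proof.
have geo m : \sum_(j < m) 2^-1 ^+ j = 2 - 2 * 2^-1 ^+ m :> R.
  elim: m => [|m IH]; first by rewrite big_ord0 expr0; ring.
  by rewrite big_ord_recr /= IH exprS; field.
rewrite -sum1_card natr_sum.
apply: (@le_trans _ _ (\sum_(f : {ffun 'I_n -> 'I_n.+1}) 2 ^+ n * \prod_i 2^-1 ^+ f i)).
  rewrite [leRHS](bigID (mem (small_cells n))) /=.
  rewrite -[leLHS]addr0; apply: lerD; last first.
    apply: sumr_ge0 => f _; rewrite mulr_ge0 ?exprn_ge0//.
    by apply: prodr_ge0 => i _; rewrite exprn_ge0 ?invr_ge0.
  apply: ler_sum => f; rewrite inE => fn; rewrite prodrXr.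
  rewrite exprVn ler_pdivlMr ?exprn_gt0// mul1r ler_weXn2l//; lra.
rewrite -mulr_sumr -(bigA_distr_bigA (fun _ (j : 'I_n.+1) => 2^-1 ^+ j)) prodr_const card_ord.
rewrite geo (_ : 4 = 2 * 2)%R ?exprMn ?ler_wpM2l ?exprn_ge0//; last by ring.
apply: lerXn2r; rewrite ?nnegrE//; last by rewrite gerBl mulr_ge0// exprn_ge0// invr_ge0.
by rewrite subr_ge0 ler_piMr// exprn_ile1 ?invr_ge0 ?invf_le1//; lra.
Qed.

(** In the coordinates [y = 1 - x T] the set lies in the simplex [y >= 0], [sum y <= n + c], which
    at most [4^n] cubes of side [(n + c)/n] cover. *)
Lemma corner_volume_le n (T : 'M[R]_n) (c : R) (A : set 'rV[R]_n) :
  (0 < n)%N -> T \in unitmx -> 0 <= c -> measurable A ->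
  (forall x, A x -> (forall k, (x *m T) 0 k <= 1) /\ - c <= \sum_k (x *m T) 0 k) ->
  (mu n A <= (`|\det T|^-1 * (4 * ((n%:R + c) / n%:R)) ^+ n)%:E)%E.
Proof.
move=> n0 uT c0 mA AT.
have nR0 : 0 < n%:R :> R by rewrite ltr0n.
pose h := (n%:R + c) / n%:R.
have h0 : 0 < h by rewrite divr_gt0// ltr_wpDr.
have NTE : - T = (-1) *: T by rewrite scaleN1r.
have uNT : - T \in unitmx.
  by rewrite NTE unitmxE detZ unitrM unitrX ?unitrN1//= -unitmxE.
pose cell (f : {ffun 'I_n -> 'I_n.+1}) := [set x : 'rV[R]_n | forall i,
  (\row_k (h * (f k)%:R)) 0 i <= (x *m (- T) + const_mx 1) 0 i <= (\row_k (h * (f k)%:R)) 0 i + h].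
have cellE f : mu n (cell f) = (`|\det T|^-1 * h ^+ n)%:E.
  rewrite lebesgue_measure_rV_cube ?ltW//.
  by rewrite NTE detZ normrM normrX normrN1 expr1n mul1r.
have mcell f : measurable (cell f) by exact: measurable_cube.
(* Cells numbered by natural numbers; the default [set0] occurs only past the range of the union. *)
pose F k := if insub k is Some i then cell (enum_val (i : 'I_#|small_cells n|)) else set0.
have AF : A `<=` \big[setU/set0]_(k < #|small_cells n|) F k.
  move=> x /AT[x1 xc].
  (* In units of [h] the coordinates sum to at most [n], so their integer parts index a small cell
     containing [x]. *)
  pose z k := (1 - (x *m T) 0 k) / h.
  have z0 k : 0 <= z k by rewrite divr_ge0 ?subr_ge0// ltW.
  have sz : \sum_k z k <= n%:R.
    rewrite -mulr_suml sumrB sumr_const card_ord ler_pdivrMr// /h mulrC divfK ?gt_eqF//.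
    by rewrite lerD2l lerNl.
  have tz : (\sum_k Num.truncn (z k) <= n)%N.
    rewrite -(ler_nat R) natr_sum; apply: le_trans sz; apply: ler_sum => k _.
    by rewrite truncn_le.
  have tn k : (Num.truncn (z k) < n.+1)%N.
    by rewrite ltnS; apply: leq_trans tz; rewrite (bigD1 k)//= leq_addr.
  pose f : {ffun 'I_n -> 'I_n.+1} := [ffun k => Ordinal (tn k)].
  have fs : f \in small_cells n.
    by rewrite inE; under eq_bigr do rewrite ffunE.
  rewrite -bigcup_mkord; exists (enum_rank_in fs f : nat); first exact: ltn_ord.
  rewrite /F valK enum_rankK_in// => i.
  have -> : (x *m - T + const_mx 1) 0 i = h * z i.
    by rewrite /z mulrC divfK ?gt_eqF// mulmxN mxE [in LHS]mxE [X in _ + X]mxE addrC.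
  rewrite mxE ffunE /= -[X in _ <= _ + X]mulr1 -mulrDr !ler_pM2l// natr1.
  by have /andP[-> /ltW ->] := truncn_itv (z0 i).
have mF k : `I_(#|small_cells n|) k -> measurable (F k).
  by move=> _; rewrite /F; case: insubP => // *; exact: mcell.
apply: le_trans (content_subadditive (mu n) mF mA AF) _.
rewrite (eq_bigr (fun=> (`|\det T|^-1 * h ^+ n)%:E)); last first.
  by move=> k _; rewrite /F valK; exact: cellE.
rewrite sumEFin lee_fin sumr_const card_ord -[leLHS]mulr_natl mulrCA ler_wpM2l ?invr_ge0//.
by rewrite -/h [leRHS]exprMn ler_wpM2r ?exprn_ge0 ?(ltW h0)// card_small_cells.
Qed.

End volume_of_corner.

(** * Selection of the half-spaces *)

Section core.
Context (R : realType).
Local Notation mu n := (lebesgue_measure_rV R n).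

(** Leibniz expansion. It serves to make a set of determinants bounded; its value does not enter the
    final constant. *)
Lemma det_le_fact n (M : 'M[R]_n) (c : R) :
  (forall i j, `|M i j| <= c) -> `|\det M| <= n`!%:R * c ^+ n.
Proof.
move=> Mc; apply: le_trans (ler_norm_sum _ _ _) _.
apply: (@le_trans _ _ (\sum_(s : 'S_n) c ^+ n)).
  apply: ler_sum => s _; rewrite normrM normrX normrN1 expr1n mul1r normr_prod.
  rewrite -[n in leRHS]card_ord -prodr_const; apply: ler_prod => i _.
  by rewrite normr_ge0 Mc.
rewrite sumr_const -[leLHS]mulr_natl (_ : #|_| = n`!)// -[RHS](card_Sn n).
exact: eq_card.
Qed.

Section centered_polyhedron.
Variables (n : nat) (I : Type) (a : I -> 'rV[R]_n) (r k : R).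
Let P := [set x : 'rV[R]_n | forall i, dot_rV x (a i) <= 1].
Hypotheses (n0 : (0 < n)%N) (k1 : 1 <= k).
Hypothesis Pr : forall x, P x -> `|x| < r.
Hypothesis Pk : forall x, P x -> forall i, - k <= dot_rV x (a i).
Hypothesis Pfull : forall u : 'rV[R]_n, u != 0 -> exists2 x, P x & dot_rV x u != 0.

(** With [M = L L^T] and [a i = lam A], the value [<x, a i>] is the product of [p = x A^T L] and
    [q = L^-1 lam^T], where [|q|^2 = lam M^-1 lam^T <= 8 n]. *)
Lemma inscribed_parallelepiped : exists (j : 'I_n -> I) (L : 'M[R]_n),
  let A := \matrix_i a (j i) in
  [/\ A \in unitmx, 0 < (\det L) ^+ 2, n`!%:R * (\det L) ^+ 2 <= 4 &
    [set x : 'rV[R]_n | forall i, `|(x *m (A^T *m L)) 0 i| <= (3 * n%:R)^-1] `<=` P].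
Proof.
have r0 : 0 < r.
  have [|x Px _] := Pfull (_ : const_mx 1 != 0).
    apply/eqP => /matrixP/(_ 0 (Ordinal n0)); rewrite !mxE => /eqP.
    by rewrite oner_eq0.
  exact: le_lt_trans (Pr Px).
(* A direction orthogonal to all normals would make the polyhedron unbounded. *)
have span_a (v : 'cV[R]_n) : v != 0 -> exists2 x, (range a) x & x *m v != 0.
  move=> v0; apply: contrapT => H.
  have av i : dot_rV v^T (a i) = 0.
    apply: contrapT => /eqP h; apply: H; exists (a i) => //.
    apply: contraNneq h => e.
    by rewrite dot_rVE -trmx_mul e trmx0 mxE.
  have nv0 : 0 < `|v^T| by rewrite normr_gt0 trmx_eq0.
  have /Pr : P ((r / `|v^T|) *: v^T) by move=> i; rewrite dot_rVZl av mulr0.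
  by rewrite normrZ normrM normfV normr_id divfK ?gt_eqF// gtr0_norm// ltxx.
have [D [PD uD]] : exists A : 'M[R]_n, (forall i, P (row i A)) /\ A \in unitmx.
  apply: unitmx_of_spanning => v v0.
  have [|x Px xv] := Pfull (_ : v^T != 0); first by rewrite trmx_eq0.
  exists x => //; apply: contraNneq xv => e.
  by rewrite dot_rVE trmxK e mxE.
(* The rows of [D] are points of [P], so the entries of [B *m D^T] lie in [[-k, 1]]. *)
have bnd_a (B : 'M[R]_n) : (forall i, (range a) (row i B)) ->
    `|\det B| <= n`!%:R * k ^+ n / `|\det D|.
  move=> aB; rewrite ler_pdivlMr ?normr_gt0 -?unitfE -?unitmxE//.
  rewrite -normrM -[\det D]det_tr -det_mulmx; apply: det_le_fact => i j.
  have [t _ tE] := aB i.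
  have -> : (B *m D^T) i j = dot_rV (row j D) (a t).
    by rewrite tE /dot_rV mxE; apply: eq_bigr => l _; rewrite !mxE mulrC.
  rewrite ler_norml Pk//=; apply: le_trans k1; exact: PD.
have [A [aA uA maxA _]] := near_max_basis span_a bnd_a.
have /choice[j jA] i : exists t, a t = row i A by have [t _ tE] := aA i; exists t.
have AE : A = \matrix_i a (j i) by apply/row_matrixP => i; rewrite rowK jA.
have dA0 : 0 < `|\det A| by rewrite normr_gt0 -unitfE -unitmxE.
pose V := [set x *m invmx A | x in range a].
have V1 i : V (row i 1%:M) by exists (row i A) => //; rewrite -row_mul mulmxV.
have V2 (B : 'M[R]_n) : (forall i, V (row i B)) -> `|\det B| <= 2.
  move=> VB; have := maxA (B *m A); rewrite det_mulmx normrM ler_pM2r//; apply.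
  by move=> i; have [x ax xE] := VB i; rewrite row_mul -xE mulmxKV.
have [M [dM M0 qM]] := near_optimal_design n0 V1 V2.
have uM : M \in unitmx by rewrite unitmxE unitfE gt_eqF.
have [L ML] := cholesky (design_sym dM) (design_posdef dM uM).
have LE : (\det L) ^+ 2 = \det M by rewrite ML det_mulmx det_tr expr2.
have uL : L \in unitmx.
  by rewrite unitmxE unitfE; apply: contraTneq M0 => L0; rewrite -LE L0 expr0n ltxx.
exists j, L; rewrite -AE; split; rewrite ?LE//.
  by have := design_det_le V2 dM; rewrite (_ : 2 ^+ 2 = 4)//; ring.
move=> x xQ i; set p := x *m (A^T *m L) in xQ.
pose lam := a i *m invmx A; pose q := invmx L *m lam^T.
have Vl : V lam by exists (a i).
have xpq : dot_rV x (a i) = \sum_t p 0 t * q t 0.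
  transitivity ((p *m q) 0 0); last by rewrite mxE.
  rewrite dot_rVE /p /q !mulmxA mulmxK// /lam trmx_mul trmx_inv mulmxA mulmxK//.
  by rewrite unitmx_tr.
have sq : \sum_t q t 0 ^+ 2 <= 8 * n%:R.
  apply: le_trans (qM _ Vl).
  have -> : lam *m invmx M *m lam^T = q^T *m q.
    have e : M *m (invmx L^T *m invmx L) = 1%:M.
      by rewrite ML mulmxA mulmxK ?unitmx_tr// mulmxV.
    have -> : invmx M = invmx L^T *m invmx L.
      by rewrite -[RHS](mulKmx uM) e mulmx1.
    by rewrite /q [(invmx L *m _)^T]trmx_mul trmxK trmx_inv !mulmxA.
  by rewrite mxE; apply: ler_sum => t _; rewrite [q^T _ _]mxE -expr2.
have nR0 : 0 < n%:R :> R by rewrite ltr0n.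
(* AM-GM: p q <= q^2 / (16 n) + 4 n p^2 *)
have step t : p 0 t * q t 0 <= (16 * n%:R)^-1 * q t 0 ^+ 2 + 4 * n%:R * (3 * n%:R)^-1 ^+ 2.
  apply: (@le_trans _ _ ((16 * n%:R)^-1 * q t 0 ^+ 2 + 4 * n%:R * p 0 t ^+ 2)).
    rewrite -subr_ge0 (_ : _ - _ = (4 * n%:R)^-1 * (q t 0 / 2 - 4 * n%:R * p 0 t) ^+ 2).
      by rewrite mulr_ge0 ?sqr_ge0// invr_ge0 mulr_ge0// ltW.
    by field; rewrite gt_eqF.
  rewrite lerD2l ler_pM2l ?mulr_gt0// -[p 0 t ^+ 2]real_normK ?num_real//.
  by apply: lerXn2r; rewrite ?nnegrE ?invr_ge0 ?mulr_ge0 ?(ltW nR0).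
rewrite xpq; apply: le_trans (ler_sum _ (fun t _ => step t)) _.
rewrite big_split /= -mulr_sumr sumr_const card_ord -[X in _ + X]mulr_natl.
apply: (@le_trans _ _ ((16 * n%:R)^-1 * (8 * n%:R) + n%:R * (4 * n%:R * (3 * n%:R)^-1 ^+ 2))).
  by rewrite lerD2r ler_wpM2l ?invr_ge0 ?mulr_ge0// ltW.
rewrite [leLHS](_ : _ = 17 / 18); last by field; rewrite gt_eqF.
by rewrite ler_pdivrMr//; lra.
Qed.

End centered_polyhedron.

(** * Numerical estimates *)

Lemma natn_le_fact n : n%:R ^+ n <= 4 ^+ n * n`!%:R :> R.
Proof.
case: n => [|n]; first by rewrite !expr0 fact0 mulr1.
rewrite -ler_pdivrMr ?ltr0n ?fact_gt0//.
have h := expR_ge1Dxn n (ler0n R n.+1).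
apply: (@le_trans _ _ (expR n.+1%:R)); first by lra.
rewrite -[n.+1%:R]mulr1 expRM_natl; apply: lerXn2r; rewrite ?nnegrE ?expR_ge0//.
exact: expR1_le4.
Qed.

(** Squaring removes the half-integral exponent. From [l^2 <= 4/n!] one gets [n^n l^2 <= 16^n], and
    [36^2 * 16 <= 36^3] concludes. *)
Lemma volume_ratio_le n (l : R) : (0 < n)%N -> 0 <= l -> n`!%:R * l ^+ 2 <= 4 ->
  (36 * n%:R ^+ 2) ^+ n * l <= (36 * n%:R) `^ (3 * n%:R / 2).
Proof.
move=> n0 l0 nl.
have c0 : 0 <= 36 * n%:R :> R by rewrite mulr_ge0.
rewrite -(@ler_pXn2r _ 2)// ?nnegrE ?powR_ge0 ?mulr_ge0 ?exprn_ge0//.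
have -> : ((36 * n%:R) `^ (3 * n%:R / 2)) ^+ 2 = (36 * n%:R : R) ^+ (3 * n).
  rewrite -powR_mulrn ?powR_ge0// -powRrM -[RHS]powR_mulrn//; congr (_ `^ _).
  by rewrite natrM; field.
have nl' : n%:R ^+ n * l ^+ 2 <= 16 ^+ n.
  apply: (@le_trans _ _ (4 ^+ n * n`!%:R * l ^+ 2)).
    by rewrite ler_wpM2r ?sqr_ge0// natn_le_fact.
  rewrite -mulrA (_ : 16 = 4 * 4)%R; last by ring.
  rewrite exprMn ler_wpM2l ?exprn_ge0//; apply: le_trans nl _.
  by rewrite -[leLHS]expr1 ler_weXn2l//; lra.
have -> : ((36 * n%:R ^+ 2) ^+ n * l) ^+ 2 =
    (36 ^+ 2 * n%:R ^+ 3) ^+ n * (n%:R ^+ n * l ^+ 2).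
  rewrite [LHS]exprMn mulrA -[X in X * _ = _]exprM mulnC exprM -[X in _ = X * _]exprMn.
  by congr (_ ^+ _ * _); ring.
rewrite exprM.
have c1 : 0 <= 36 ^+ 2 * n%:R ^+ 3 :> R by rewrite mulr_ge0 ?exprn_ge0.
apply: (@le_trans _ _ ((36 ^+ 2 * n%:R ^+ 3) ^+ n * 16 ^+ n)).
  by apply: ler_wpM2l nl'; exact: exprn_ge0.
rewrite -exprMn; apply: lerXn2r; rewrite ?nnegrE ?exprn_ge0 ?mulr_ge0//.
rewrite exprMn [leRHS](_ : _ = 36 ^+ 2 * n%:R ^+ 3 * 36); last by ring.
by rewrite ler_wpM2l// ler_nat.
Qed.

Section selection.
Variables (n : nat) (I : Type) (a : I -> 'rV[R]_n) (r : R).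
Let P := [set x : 'rV[R]_n | forall i, dot_rV x (a i) <= 1].
Hypothesis n0 : (0 < n)%N.
Hypothesis Pr : forall x, P x -> `|x| < r.
Hypothesis Pk : forall x, P x -> forall i, - (2 * n.+1%:R) <= dot_rV x (a i).
Hypothesis Pfull : forall u : 'rV[R]_n, u != 0 -> exists2 x, P x & dot_rV x u != 0.

Lemma select_halfspaces : exists s (j : 'I_s -> I), (s <= 2 * n)%N /\
  (mu n [set x : 'rV[R]_n | forall t, (dot_rV x (a (j t)) <= 1)%R] <=
   ((36 * n%:R) `^ (3 * n%:R / 2))%:E * mu n P)%E.
Proof.
have k1 : 1 <= 2 * n.+1%:R :> R by rewrite -natrM ler1n muln_gt0.
have [j0 [L]] := inscribed_parallelepiped n0 k1 Pr Pk Pfull.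
set A := \matrix_i a (j0 i) => -[uA L0 nL QP].
have nR1 : 1 <= n%:R :> R by rewrite ler1n.
have nR0 : 0 < n%:R :> R by rewrite ltr0n.
have yE x i : (x *m A^T) 0 i = dot_rV x (a (j0 i)).
  by rewrite mxE; apply: eq_bigr => l _; rewrite !mxE.
pose w := \sum_i (-1) *: a (j0 i).
have wE x : dot_rV x w = - \sum_i (x *m A^T) 0 i.
  have dotC u v : dot_rV u v = dot_rV v u :> R.
    by apply: eq_bigr => l _; rewrite mulrC.
  rewrite dotC dot_rV_suml -sumrN; apply: eq_bigr => i _.
  by rewrite yE mulN1r dotC.
(* Each of the [n] chosen functionals is at least [-2(n+1)] on [P]; the 1 makes the inequality
   strict. *)
pose c : R := n%:R * (2 * n.+1%:R) + 1.
have c0 : 0 < c by rewrite ltr_wpDl// mulr_ge0// mulr_ge0.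
have [|m [j1 [mn Hw]]] := @helly_functional R n I a w c r c0.
  move=> x Px; split; first exact: Pr.
  rewrite wE ltrNl; apply: (@lt_le_trans _ _ (\sum_(i < n) - (2 * n.+1%:R))).
    rewrite sumr_const card_ord -[ltRHS]mulr_natl /c; lra.
  by apply: ler_sum => i _; rewrite yE Pk.
pose j (t : 'I_(n + m)) := match fintype.split t with inl i => j0 i | inr i => j1 i end.
exists (n + m)%N, j; split; first by rewrite mul2n -addnn leq_add2l.
pose rho : R := (3 * n%:R)^-1.
have rho0 : 0 < rho by rewrite invr_gt0 mulr_gt0.
have uT : A^T *m L \in unitmx.
  rewrite unitmx_mul unitmx_tr uA unitmxE unitfE /=.
  by apply: contraTneq L0 => ->; rewrite expr0n ltxx.
have QE : [set x : 'rV[R]_n | forall i, `|(x *m (A^T *m L)) 0 i| <= (3 * n%:R)^-1] =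
  [set x : 'rV[R]_n | forall i, (const_mx (- rho) : 'rV[R]_n) 0 i <=
    (x *m (A^T *m L) + 0) 0 i <= (const_mx (- rho) : 'rV[R]_n) 0 i + 2 * rho].
  apply/seteqP; split=> x xQ i; have := xQ i;
  by rewrite addr0 [const_mx _ _ _]mxE ler_norml (_ : - rho + 2 * rho = rho)//; ring.
have muQ : ((`|\det (A^T *m L)|^-1 * (2 * rho) ^+ n)%:E <= mu n P)%E.
  rewrite -(lebesgue_measure_rV_cube 0 (const_mx (- rho)))//; last by rewrite mulr_ge0// ltW.
  apply: le_lebesgue_measure_rV; [exact: measurable_cube|exact: measurable_polyhedron|].
  by rewrite -QE.
apply: (@le_trans _ _ (((36 * n%:R) `^ (3 * n%:R / 2))%:E *
    (`|\det (A^T *m L)|^-1 * (2 * rho) ^+ n)%:E)%E); last first.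
  by rewrite lee_pmul2l// ?lte_fin ?powR_gt0 ?mulr_gt0.
have uAT : A^T \in unitmx by rewrite unitmx_tr.
apply: le_trans (corner_volume_le (T := A^T) (c := c) n0 uAT (ltW c0) _ _) _.
- exact: measurable_polyhedron.
- move=> x xG; split=> [i|].
    by have := xG (lshift m i); rewrite /j -[lshift m i]/(unsplit (inl i)) unsplitK yE.
  rewrite lerNl -wE ltW//; apply: Hw => i.
  by have := xG (rshift n i); rewrite /j -[rshift n i]/(unsplit (inr i)) unsplitK.
rewrite -EFinM lee_fin det_mulmx normrM invfM det_tr.
rewrite -(mulrA `|\det A|^-1) [leRHS]mulrCA ler_wpM2l ?invr_ge0//.
have l0 : 0 < `|\det L| by rewrite normr_gt0 -sqrf_eq0 gt_eqF.
have rn0 : 0 < (2 * rho) ^+ n by rewrite exprn_gt0// mulr_gt0.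
have nlL : n`!%:R * `|\det L| ^+ 2 <= 4 by rewrite real_normK ?num_real.
have V := volume_ratio_le n0 (ltW l0) nlL.
(* Per dimension the corner costs [4 (n + c)/n = 4 (2n^2 + 3n + 1)/n <= 24 n], and
   [24 n = 36 n^2 * (2 rho)]: hence the constant 36. *)
apply: (@le_trans _ _ ((36 * n%:R ^+ 2) ^+ n * `|\det L| * (`|\det L|^-1 * (2 * rho) ^+ n))).
  rewrite [leRHS]mulrA mulfK ?gt_eqF// -exprMn; apply: lerXn2r; rewrite ?nnegrE.
  - by rewrite mulr_ge0// divr_ge0// addr_ge0// ltW.
  - by rewrite !mulr_ge0// ?exprn_ge0// ltW.
  rewrite (_ : 36 * n%:R ^+ 2 * (2 * rho) = 4 * (6 * n%:R)); last first.
    by rewrite /rho; field; rewrite gt_eqF.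
  rewrite ler_pM2l// ler_pdivrMr// /c -natr1; nra.
by rewrite ler_wpM2r// mulr_ge0 ?invr_ge0// ltW.
Qed.
End selection.
End core.

(** * Reduction of an arbitrary family to a centered polyhedron *)

Theorem theorem1p1 (R : realType) :
  exists C : R, 0 < C /\
    forall n : nat, (1 <= n)%N ->
    forall (I : Type) (P : I -> set 'rV[R]_n),
      (forall i : I, closed_half_space (P i)) ->
      (0 < lebesgue_measure_rV R n (\bigcap_(i in [set: I]) P i))%E ->
      exists (s : nat) (j : 'I_s -> I),
        (s <= 2 * n)%N /\
        (lebesgue_measure_rV R n (\bigcap_(k in [set: 'I_s]) P (j k)) <=
         ((C * n%:R) `^ (3 * n%:R / 2))%:E *
           lebesgue_measure_rV R n (\bigcap_(i in [set: I]) P i))%E.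
Proof.
exists 36; split=> // n n0 I P hP.
have /choice[u /choice[b uP]] : forall i, exists u, exists b,
    u != 0 /\ P i = [set x | dot_rV x u <= b] by [].
have Pub i := (uP i).2.
have capE J (f : J -> I) : \bigcap_(i in [set: J]) P (f i) =
    [set x | forall i, dot_rV x (u (f i)) <= b (f i)].
  by apply/seteqP; split=> [x xP i|x xP i _]; have := xP i; rewrite Pub//; exact.
rewrite (capE I id); set Q := [set x | _] => Q0.
(* For infinite volume the right-hand side is infinite, and [s = 0] works. *)
have [Qoo|] := ltP (lebesgue_measure_rV R n Q) +oo%E; last first.
  rewrite leye_eq => /eqP ->; exists 0%N, (fun i : 'I_0 => False_rect I (notF (ltn_ord i))).
  by split=> //; rewrite gt0_muley ?leey// lte_fin powR_gt0// mulr_gt0// ltr0n.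
have [ctr [r [Qo Qr]]] := exists_center n0 Q0 Qoo.
have mQ : measurable Q by exact: measurable_polyhedron.
set k : R := 2 * n.+1%:R in Qo.
have k0 : 0 < k by rewrite mulr_gt0// ltr0n.
have ki0 : 0 < k^-1 by rewrite invr_gt0.
have Qok x i : Q x -> dot_rV ctr (u i) - k^-1 * (dot_rV x (u i) - dot_rV ctr (u i)) <= b i.
  by move=> /Qo/(_ i); rewrite dot_rVBl dot_rVZl dot_rVBl.
(* The center is interior to each half-space: if it were not, a point of [Q] strictly inside the
   half-space would be reflected strictly outside it. *)
have d0 i : 0 < b i - dot_rV ctr (u i).
  have [x Qx xb] := not_in_hyperplane (b i) mQ Q0 (uP i).1.
  have xlt : dot_rV x (u i) < b i by rewrite lt_neqAle xb Qx.
  have h := Qok x i Qx.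
  rewrite subr_gt0 ltNge; apply/negP => ob.
  have : 0 < k^-1 * (dot_rV ctr (u i) - dot_rV x (u i)).
    by rewrite mulr_gt0// subr_gt0; exact: lt_le_trans ob.
  by move: h; lra.
pose a i := (b i - dot_rV ctr (u i))^-1 *: u i.
have aE x i : (dot_rV x (a i) <= 1) = (dot_rV (x + ctr) (u i) <= b i).
  by rewrite dot_rVZr mulrC ler_pdivrMr// mul1r dot_rVDl lerBrDr.
have shift J (f : J -> I) :
    lebesgue_measure_rV R n [set x | forall t, (dot_rV x (a (f t)) <= 1)%R] =
    lebesgue_measure_rV R n [set x | forall t, (dot_rV x (u (f t)) <= b (f t))%R].
  rewrite -[RHS](lebesgue_measure_rV_translate ctr); last exact: measurable_polyhedron.
  by congr (lebesgue_measure_rV R n _); apply/seteqP; split=> x xP t; have := xP t; rewrite /= aE.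
have Qa x : (forall i, dot_rV x (a i) <= 1) -> Q (x + ctr).
  by move=> xa i; rewrite -aE.
(* After translation by [ctr] and normalization, membership of the reflected point in [Q] reads
   [<x, a i> >= -k]. *)
have [|||s [j [sn Hj]]] := @select_halfspaces R n I a (r + `|ctr|) n0.
- move=> x /Qa/Qr xr; rewrite -[x](addrK ctr); apply: le_lt_trans (ler_normB _ _) _.
  by rewrite ltrD2r.
- move=> x /Qa Qx i; rewrite dot_rVZr [leRHS]mulrC ler_pdivlMr//.
  have := Qok _ i Qx; rewrite dot_rVDl addrK => h.
  have : k^-1 * (- dot_rV x (u i)) <= b i - dot_rV ctr (u i) by lra.
  by rewrite mulrC ler_pdivrMr// -/k; lra.
- move=> v v0; have [x Qx xv] := not_in_hyperplane (dot_rV ctr v) mQ Q0 v0.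
  exists (x - ctr); first by move=> i; rewrite aE subrK.
  by rewrite dot_rVBl subr_eq0.
exists s, j; split=> //.
by rewrite capE -(shift _ j) -(shift _ id).
Qed.
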